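(* Fix $p\ge3$ and let $(\beta,h)\in\Theta$ be $p$-regular, with $\beta$ known and $\bm X\sim\mathbb P_{\beta,h,p}$. Let $m_*$ be the unique global maximizer of $H=H_{\beta,h,p}$. Then as $N\to\infty$, $N^{1/2}(\hat h_N-h)\to N(0,-H''(m_* ))$ in distribution.
   Context: The $p$-tensor Curie–Weiss model on $\{-1,1\}^N$: $\mathbb P_{\beta,h,p}(\bm X)=\frac{1}{2^NZ_N(\beta,h,p)}\exp\{N(\beta\bar X_N^p+h\bar X_N)\}$ with $\bar X_N=N^{-1}\sum_iX_i$, for $(\beta,h)\in\mathbb R^2$; $\Theta=[0,\infty)\times\mathbb R$. $\mathbb E_{\beta,h,p}$ denotes expectation under it. $I(x)=\frac12[(1+x)\log(1+x)+(1-x)\log(1-x)]$, $H_{\beta,h,p}(x)=\beta x^p+hx-I(x)$ on $[-1,1]$. $(\beta,h)$ is $p$-regular if $H_{\beta,h,p}$ has a unique global maximizer $m_*\in(-1,1)$ with $H''(m_* )<0$. For known $\beta$, the maximum likelihood estimate $\hat h_N\in[-\infty,\infty]$ is the maximizer of the likelihood over $h\in\mathbb R$, equivalently the solution in $h$ of $\mathbb E_{\beta,h,p}(\bar X_N)=\bar X_N$. *)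

(* Defs.v *)
From HB Require Import structures.
From mathcomp Require Import all_boot all_order all_algebra.
From mathcomp Require Import all_classical all_reals all_analysis.
Set Implicit Arguments. Unset Strict Implicit. Unset Printing Implicit Defensive.
Import Order.TTheory GRing.Theory Num.Theory.
Import numFieldNormedType.Exports.
Local Open Scope classical_set_scope.
Local Open Scope ring_scope.

Section CW.
Variable R : realType.

Definition config (N : nat) := {ffun 'I_N -> bool}.
Definition spin (b : bool) : R := if b then 1 else -1.

Definition xbar (N : nat) (x : config N) : R :=
  (N%:R)^-1 * \sum_(i < N) spin (x i).

Definition cw_weight (N : nat) (beta h : R) (p : nat) (x : config N) : R :=
  expR (N%:R * (beta * xbar x ^+ p + h * xbar x)).

Definition cw_Z (N : nat) (beta h : R) (p : nat) : R :=
  (2 ^+ N)^-1 * \sum_(x : config N) cw_weight beta h p x.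

Definition cw_prob (N : nat) (beta h : R) (p : nat) (x : config N) : R :=
  cw_weight beta h p x / (2 ^+ N * cw_Z N beta h p).

Definition cw_Prob (N : nat) (beta h : R) (p : nat) (A : pred (config N)) : R :=
  \sum_(x : config N | A x) cw_prob beta h p x.

Definition cw_mean (N : nat) (beta h : R) (p : nat) : R :=
  \sum_(x : config N) cw_prob beta h p x * xbar x.

(* the mean extended to h in [-oo,+oo] (limits +1 / -1 at +oo / -oo) *)
Definition cw_meanE (N : nat) (beta : R) (p : nat) (e : \bar R) : R :=
  match e with
  | EFin h => cw_mean N beta h p
  | +oo%E => 1
  | -oo%E => -1
  end.

Definition mle_h (N : nat) (beta : R) (p : nat) (x : config N) : \bar R :=
  xget 0%E [set e : \bar R | cw_meanE N beta p e = xbar x].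

Definition Ient (x : R) : R :=
  2^-1 * ((1 + x) * ln (1 + x) + (1 - x) * ln (1 - x)).

Definition Hfun (beta h : R) (p : nat) (x : R) : R :=
  beta * x ^+ p + h * x - Ient x.

Definition p_regular (beta h : R) (p : nat) : Prop :=
  exists m : R,
    [/\ -1 < m < 1,
        (forall x, -1 <= x <= 1 -> x != m -> Hfun beta h p x < Hfun beta h p m)
      & derive1 (derive1 (Hfun beta h p)) m < 0].

End CW.

Arguments xbar {R N} x.
Arguments cw_weight {R N} beta h p x.
Arguments cw_Z {R} N beta h p.
Arguments cw_prob {R N} beta h p x.
Arguments cw_Prob {R} N beta h p A.
Arguments cw_mean {R} N beta h p.
Arguments cw_meanE {R} N beta p e.
Arguments mle_h {R} N beta p x.
Arguments Ient {R} x.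
Arguments Hfun {R} beta h p x.
Arguments p_regular {R} beta h p.

(* Main.v *)
(** With [x_k = 2k/N - 1] and [c(k) = k^k e^{-k} / k!], the law of the mean spin
    under the Curie-Weiss measure gives [x_k] a weight proportional to
    [c(k) c(N-k) exp (N H(x_k))], exactly.  Since [c] decreases while [k c(k)]
    increases, [c(k) c(N-k)] is asymptotically constant near the maximizer [m] and
    at most polynomially large elsewhere, so no Stirling formula is needed.  In the
    coordinate [y = kappa sqrt N (x - m)], [kappa = - H''(m)], the sums over [k]
    become integrals of step functions, and dominated convergence turns them into
    Gaussian integrals of variance [kappa].  Changing the field to [h + t / sqrt N]
    tilts the weights by [exp (t y / kappa)], which moves the limiting mean of [y]
    to [t].  As the mean is strictly increasing in the field, the event
    [sqrt N (mle - h) <= t] says that [y] is at most its mean in the field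
    [h + t / sqrt N], and the probability of this tends to [P (N(0, kappa) <= t)]. *)
Require Import Defs.
From HB Require Import structures.
From mathcomp Require Import all_boot all_order all_algebra.
From mathcomp Require Import all_classical all_reals all_analysis.
From mathcomp Require Import measurable_realfun ring lra.
Set Implicit Arguments. Unset Strict Implicit. Unset Printing Implicit Defensive.
Import Order.TTheory GRing.Theory Num.Theory.
Import numFieldNormedType.Exports.
Local Open Scope classical_set_scope.
Local Open Scope ring_scope.

(** * Monotonicity of [k^k e^-k / k!] and of [k] times it *)

Definition stirling_ratio {R : realType} (k : nat) : R :=
  k%:R ^+ k * expR (- k%:R) / k`!%:R.

Section StirlingRatio.
Variable R : realType.
Local Notation c := (@stirling_ratio R).

Lemma stirling_ratio_gt0 k : 0 < c k.
Proof.
rewrite divr_gt0 ?ltr0n ?fact_gt0// mulr_gt0 ?expR_gt0//.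
by case: k => [|k]; rewrite ?expr0// exprn_gt0.
Qed.

(** Both monotonicity properties are read off this quotient: with [j = k + 1] they amount to
    [(1 + 1/j)^j <= e <= (1 + 1/j)^(j+1)]. *)
Lemma stirling_ratioS k :
  c k.+2 = c k.+1 * (expR (-1) * (1 + (k.+1%:R)^-1) ^+ k.+1).
Proof.
have k0 : k.+1%:R != 0 :> R by rewrite pnatr_eq0.
have -> : 1 + (k.+1%:R)^-1 = k.+2%:R / k.+1%:R :> R.
  by rewrite [k.+2%:R]mulrSr mulrDl divff// mul1r.
rewrite /stirling_ratio factS natrM invfM exprMn exprVn.
have -> : - k.+2%:R = -1 - k.+1%:R :> R by rewrite [k.+2%:R]mulrSr opprD addrC.
rewrite expRD exprS.
have f0 : (k.+1)`!%:R != 0 :> R by rewrite pnatr_eq0 -lt0n fact_gt0.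
have k2 : k.+2%:R != 0 :> R by rewrite pnatr_eq0.
have ke : k.+1%:R ^+ k.+1 != 0 :> R by rewrite expf_neq0.
move: (k.+1%:R ^+ k.+1) (k.+2%:R ^+ k.+1) ke (k.+1)`!%:R f0 => a b a0 f f0.
by field; apply/and3P.
Qed.

Lemma stirling_ratio1 : c 1 = expR (-1).
Proof. by rewrite /stirling_ratio expr1 mul1r divr1. Qed.

Lemma stirling_ratio0 : c 0 = 1.
Proof. by rewrite /stirling_ratio expr0 mul1r fact0 divr1 oppr0 expR0. Qed.

Lemma stirling_ratio_leS k : c k.+1 <= c k.
Proof.
case: k => [|k]; first by rewrite stirling_ratio1 stirling_ratio0 expR_le1; lra.
rewrite stirling_ratioS ler_piMr//; first exact/ltW/stirling_ratio_gt0.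
rewrite expRN ler_pdivrMl ?expR_gt0// mulr1.
apply: (@le_trans _ _ (expR (k.+1%:R^-1) ^+ k.+1)).
  by rewrite lerXn2r ?nnegrE ?expR_ge0 ?addr_ge0// expR_ge1Dx.
by rewrite -expRM_natr mulVf ?pnatr_eq0.
Qed.

Lemma stirling_ratio_geS k : k%:R * c k <= k.+1%:R * c k.+1.
Proof.
case: k => [|k]; first by rewrite mul0r mulr_ge0// ltW// stirling_ratio_gt0.
rewrite stirling_ratioS.
set e := expR (-1); set q := 1 + _.
have q0 : 0 < q by rewrite addr_gt0.
have -> : k.+2%:R = k.+1%:R * q :> R.
  by rewrite /q mulrDr mulr1 divff ?pnatr_eq0// -natr1.
rewrite [leRHS](_ : _ = k.+1%:R * c k.+1 * (e * q ^+ k.+2)); last first.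
  by rewrite (exprS q k.+1); ring.
have ck : 0 <= k.+1%:R * c k.+1 by rewrite mulr_ge0// ltW// stirling_ratio_gt0.
rewrite ler_peMr//.
rewrite /e expRN ler_pdivlMl ?expR_gt0// mulr1.
(* The lower bound on [q] comes from inverting [1 - 1/(k+2) <= exp (- 1/(k+2))], whose left side is
   [1/q]. *)
have := @expR_ge1Dx R (- k.+2%:R^-1).
have -> : 1 - k.+2%:R^-1 = q^-1 :> R.
  have k0 : k.+1%:R != 0 :> R by rewrite pnatr_eq0.
  have k1 : k.+2%:R != 0 :> R by rewrite pnatr_eq0.
  rewrite /q; have : k.+2%:R = k.+1%:R + 1 :> R by rewrite -natr1.
  move: (k.+1%:R) (k.+2%:R) k0 k1 => a b a0 b0 bE; subst b.
  by field; rewrite ?(addrC 1) ?b0 ?a0.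
rewrite expRN lef_pV2 ?posrE ?expR_gt0// => h.
have : expR (k.+2%:R^-1) ^+ k.+2 <= q ^+ k.+2.
  by rewrite lerXn2r ?nnegrE ?expR_ge0// ltW.
by rewrite -expRM_natr mulVf ?pnatr_eq0.
Qed.

Lemma stirling_ratio_le j k : (j <= k)%N -> c k <= c j.
Proof.
move=> /subnKC <-; elim: (k - j)%N => [|n ih]; first by rewrite addn0.
by rewrite addnS; exact: le_trans (stirling_ratio_leS _) ih.
Qed.

Lemma stirling_ratio_ge j k : (j <= k)%N -> j%:R * c j <= k%:R * c k.
Proof.
move=> /subnKC <-; elim: (k - j)%N => [|n ih]; first by rewrite addn0.
by rewrite addnS; exact: le_trans ih (stirling_ratio_geS _).
Qed.

(** The two opposite monotonicities place [c j / c k] between 1 and [k / j], whichever index is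
    larger. *)
Lemma stirling_ratio_near1 j k : (0 < j)%N -> (0 < k)%N ->
  `|c j / c k - 1| <= `|k%:R / j%:R - 1|.
Proof.
move=> j0 k0.
have cj := stirling_ratio_gt0 j; have ck := stirling_ratio_gt0 k.
have j0' : 0 < j%:R :> R by rewrite ltr0n.
have k0' : 0 < k%:R :> R by rewrite ltr0n.
have [jk|/ltnW kj] := leqP j k.
  have cr : 1 <= c j / c k by rewrite ler_pdivlMr// mul1r stirling_ratio_le.
  have kr : 1 <= k%:R / j%:R :> R by rewrite ler_pdivlMr// mul1r ler_nat.
  rewrite !ger0_norm ?subr_ge0// lerB// ler_pdivrMr// mulrAC ler_pdivlMr//.
  by rewrite mulrC stirling_ratio_ge.
have cr : c j / c k <= 1 by rewrite ler_pdivrMr// mul1r stirling_ratio_le.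
have kr : k%:R / j%:R <= 1 :> R by rewrite ler_pdivrMr// mul1r ler_nat.
rewrite !ler0_norm ?subr_le0// lerN2 lerB// ler_pdivlMr// mulrAC ler_pdivrMr//.
by rewrite (mulrC (c j)) stirling_ratio_ge.
Qed.

(** For [j < k] the growth of [i c(i)] gives [k / j]. Writing [j.+1] keeps the bound meaningful at
    [j = 0]; the factor [e] pays for [(j+1)/j <= 2 <= e], and at [j = 0] for [c 0 / c 1 = e]. *)
Lemma stirling_ratio_ub j k :
  c j / c k <= expR 1 * (1 + k%:R / j.+1%:R).
Proof.
have cj := stirling_ratio_gt0 j; have ck := stirling_ratio_gt0 k.
have e2 : 2 <= expR 1 :> R by have := @expR_ge1Dx R 1; lra.
have [kj|jk] := leqP k j.
  apply: (@le_trans _ _ 1).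
    by rewrite ler_pdivrMr// mul1r stirling_ratio_le.
  rewrite -[leLHS]mulr1 ler_pM//; first lra.
  by rewrite lerDl divr_ge0.
apply: (@le_trans _ _ (expR 1 * (k%:R / j.+1%:R))); last first.
  by rewrite ler_wpM2l ?expR_ge0// lerDr.
rewrite ler_pdivrMr//.
rewrite [leRHS](_ : _ = expR 1 * (k%:R * c k) / j.+1%:R); last by ring.
rewrite ler_pdivlMr// mulrC.
have [->|j0] := eqVneq j 0%N.
  rewrite stirling_ratio0 mulr1.
  have := @stirling_ratio_ge 1 k (leq_trans (ltn0Sn _) jk).
  rewrite mul1r stirling_ratio1 expRN => h.
  by rewrite -(@ler_pdivrMl _ (expR 1)) ?expR_gt0// mulr1.
apply: (@le_trans _ _ (2 * (j%:R * c j))).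
  have j2 : j.+1%:R <= 2 * j%:R :> R.
    by rewrite -natrM ler_nat mul2n -addnn -addn1 leq_add2l lt0n.
  by rewrite mulrA; apply: ler_wpM2r => //; exact: ltW.
apply: ler_pM => //; first by rewrite mulr_ge0// ltW.
exact/stirling_ratio_ge/ltnW.
Qed.

End StirlingRatio.

(** * Sums over a grid as integrals of step functions *)

Section StepFunction.
Variable R : realType.
Local Notation mu := (@lebesgue_measure R).
Implicit Types (a d y : R) (n k : nat) (A : nat -> R).

Definition cell a d k : set R := `[a + k%:R * d, a + k.+1%:R * d[.

Definition step_fun a d n A y : R := \sum_(k < n) A k * \1_(cell a d k) y.

Lemma measurable_cell a d k : measurable (cell a d k).
Proof. exact: measurable_itv. Qed.

Lemma measurable_step_fun a d n A : measurable_fun setT (step_fun a d n A).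
Proof.
apply: measurable_sum => k; apply: measurable_funM => //.
by apply: measurable_indic; exact: measurable_cell.
Qed.

Lemma integral_step_fun a d n A : 0 < d ->
  (\int[mu]_y (step_fun a d n A y)%:E = (d * \sum_(k < n) A k)%:E)%E.
Proof.
move=> d0.
have icell k : mu.-integrable setT (EFin \o \1_(cell a d k)).
  exact: integrable_indic_itv.
under eq_integral do rewrite /step_fun -sumEFin.
have integral_cell k : (\int[mu]_y (\1_(cell a d k) y)%:E = d%:E)%E.
  rewrite integral_indic//; last exact: measurable_cell.
  rewrite setIT; apply: etrans (lebesgue_measure_itv _) _; rewrite /= lte_fin ltrD2l ltr_pM2r//.
  by rewrite ltr_nat ltnSn -EFinB; congr EFin; rewrite -natr1; ring.
rewrite integral_sum//=; last first.
  move=> k; rewrite (_ : (fun y => _) =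
    (fun y => (A k)%:E * (\1_(cell a d k) y)%:E)%E); last first.
    by apply/funext => y; rewrite EFinM.
  by apply: integrableZl => //; exact: icell.
rewrite mulr_sumr -sumEFin; apply: eq_bigr => k _.
under eq_integral do rewrite EFinM.
rewrite integralZl//; last exact: icell.
by rewrite integral_cell -EFinM mulrC.
Qed.

Lemma trivIset_cell a d j k y : 0 < d -> cell a d j y -> cell a d k y -> j = k.
Proof.
rewrite /cell/= !in_itv/= => d0 /andP[j1 j2] /andP[k1 k2].
have jk : (j < k.+1)%N.
  by rewrite -(@ltr_nat R) -(ltr_pM2r d0) -(ltrD2l a); exact: le_lt_trans k2.
have kj : (k < j.+1)%N.
  by rewrite -(@ltr_nat R) -(ltr_pM2r d0) -(ltrD2l a); exact: le_lt_trans j2.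
by apply/eqP; rewrite eqn_leq -ltnS jk -ltnS.
Qed.

Lemma step_fun_cell a d n A k y : 0 < d -> (k < n)%N -> cell a d k y ->
  step_fun a d n A y = A k.
Proof.
move=> d0 kn ky; rewrite /step_fun (bigD1 (Ordinal kn))//=.
rewrite indicE mem_set// mulr1 big1 ?addr0// => i ik.
rewrite indicE memNset ?mulr0// => iy; move/eqP : ik; apply; apply: val_inj => /=.
exact: trivIset_cell d0 iy ky.
Qed.

Lemma step_fun_ub a d n A y M : 0 < d -> 0 <= M ->
  (forall k, (k < n)%N -> cell a d k y -> `|A k| <= M) ->
  `|step_fun a d n A y| <= M.
Proof.
move=> d0 M0 h.
have [[k [kn ky]]|nk] := pselect (exists k, (k < n)%N /\ cell a d k y).
  by rewrite (step_fun_cell _ d0 kn ky); exact: h.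
rewrite /step_fun big1 ?normr0// => k _.
by rewrite indicE memNset ?mulr0// => ky; apply: nk; exists k.
Qed.

(** The sum is exactly the integral of a step function, so dominated convergence applies. The
    pointwise limit is phrased along indices [k N] of cells containing [y], for large [N] only,
    since the grid may reach [y] late. *)
Lemma riemann_sum_cvg (a d : R^nat) (n : nat -> nat) (A : nat -> nat -> R)
    (f g : R -> R) :
  (forall N, 0 < d N) -> measurable_fun setT f ->
  (forall y, 0 <= g y) -> mu.-integrable setT (EFin \o g) ->
  (forall N k y, (k < n N)%N -> cell (a N) (d N) k y -> `|A N k| <= g y) ->
  {ae mu, forall y, exists2 k : nat -> nat,
    \forall N \near \oo, (k N < n N)%N /\ cell (a N) (d N) (k N) y
    & A N (k N) @[N --> \oo] --> f y} ->
  (d N * \sum_(k < n N) A N k)%:E @[N --> \oo] --> (\int[mu]_y (f y)%:E)%E.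
Proof.
move=> d0 mf g0 ig Ag Af.
have := @dominated_convergence _ _ _ mu setT measurableT
  (fun N y => (step_fun (a N) (d N) (n N) (A N) y)%:E) (EFin \o f) (EFin \o g).
case => //.
- by move=> N; apply/measurable_EFinP; exact: measurable_step_fun.
- exact/measurable_EFinP.
- move: Af; apply: filterS; first exact: (ae_filter_ringOfSetsType mu).
  move=> y [k kn kf] _; apply: cvg_EFin; first exact: nearW.
  apply: cvg_trans kf; apply: near_eq_cvg.
  by apply: filterS kn => N [kN ky]; rewrite /= (step_fun_cell _ (d0 N) kN ky).
- by apply: aeW => y N _ /=; rewrite lee_fin; apply: step_fun_ub => // k; exact: Ag.
move=> _ _ h; apply: cvg_trans h; apply: near_eq_cvg; apply: nearW => N.
by rewrite /= integral_step_fun.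
Qed.

End StepFunction.

(** * Second-order expansions, quadratic bounds at a strict maximum, and [x ln x] *)

Section SecondOrder.
Variable R : realType.
Implicit Types (f df : R -> R) (m l x y e : R).

Lemma is_derive_first_order f m l e : is_derive m 1 f l -> 0 < e ->
  \forall x \near m, `|f x - f m - l * (x - m)| <= e * `|x - m|.
Proof.
case=> fm fl e0.
have : h^-1 *: (f (h *: 1 + m) - f m) @[h --> (0:R)^'] --> l.
  by rewrite -fl; exact: fm.
move=> /cvgrPdist_le/(_ _ e0).
rewrite /dnbhs/= => /nbhs_ballP[d /= d0 hd].
apply/nbhs_ballP; exists d => //= x /= xd.
have [->|xm] := eqVneq x m; first by rewrite !subrr mulr0 subr0 normr0 mulr0.
have x0 : x - m != 0 by rewrite subr_eq0.
have := hd (x - m).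
rewrite /ball/= sub0r normrN distrC => /(_ xd x0).
rewrite /GRing.scale/= mulr1 subrK => h.
rewrite -[_ - _ - _](_ : - ((l - (x - m)^-1 * (f x - f m)) * (x - m)) = _); last by field.
by rewrite normrN normrM (distrC m x) ler_wpM2r.
Qed.

(** Mean value theorem for [f] minus its quadratic part: the first-order expansion of [df] at [m]
    bounds the derivative of the remainder by [e |x - m|] between [m] and [x]. *)
Lemma second_order f df m l e :
  (\forall x \near m, is_derive (x : R) (1 : R) f (df x)) -> df m = 0 ->
  is_derive m 1 df l -> 0 < e ->
  \forall x \near m, `|f x - f m - l / 2 * (x - m) ^+ 2| <= e * (x - m) ^+ 2.
Proof.
move=> fdf df0 dfl e0.
have := is_derive_first_order dfl e0; rewrite df0.
move: fdf => /nbhs_ballP[d1 /= d10 h1] /nbhs_ballP[d2 /= d20 h2].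
pose d := Num.min d1 d2.
apply/nbhs_ballP; exists d; first by rewrite /= lt_min d10.
move=> x; rewrite /ball/= /d lt_min => /andP[xd1 xd2].
pose g y := f y - l / 2 * (y - m) ^+ 2.
pose dg y := df y - l * (y - m).
have gdg y : `|m - y| < d1 -> is_derive y 1 g (dg y).
  move=> yd; have fy := h1 _ yd; rewrite /g /dg.
  apply: is_derive_eq; rewrite /GRing.scale/=; lra.
have -> : f x - f m - l / 2 * (x - m) ^+ 2 = g x - g m.
  by rewrite /g subrr expr0n/= mulr0 subr0; ring.
have dgub y : `|m - y| <= `|m - x| -> `|dg y| <= e * `|x - m|.
  move=> yx; have := h2 y (le_lt_trans yx xd2); rewrite subr0 => /le_trans; apply.
  by rewrite ler_pM2l// (distrC y) (distrC x).
have sq : `|x - m| * `|x - m| = (x - m) ^+ 2 by rewrite -expr2 real_normK ?num_real.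
have [xm|mx|->] := ltgtP x m; last by rewrite subrr normr0 mulr_ge0 ?sqr_ge0 ?ltW.
- have inside y : y \in `[x, m] -> `|m - y| <= `|m - x|.
    rewrite in_itv/= => /andP[xy ym].
    by rewrite !ger0_norm ?subr_ge0 ?(ltW xm)// lerD2l lerN2.
  have [||c cxm] := @MVT R g dg x m xm.
  + move=> y yxm; apply: gdg; apply: le_lt_trans (inside y _) xd1.
    exact: subset_itvW yxm.
  + apply: derivable_within_continuous => y yx.
    have : `|m - y| < d1 by apply: le_lt_trans (inside y yx) xd1.
    by case/gdg.
  rewrite distrC => ->; rewrite normrM -sq mulrA (distrC m) ler_wpM2r//.
  by apply/dgub/inside; exact: subset_itvW cxm.
- have inside y : y \in `[m, x] -> `|m - y| <= `|m - x|.
    rewrite in_itv/= => /andP[my yx].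
    by rewrite !ler0_norm ?subr_le0 ?(ltW mx)// !opprB lerD2r.
  have [||c cmx] := @MVT R g dg m x mx.
  + move=> y ymx; apply: gdg; apply: le_lt_trans (inside y _) xd1.
    exact: subset_itvW ymx.
  + apply: derivable_within_continuous => y yx.
    have : `|m - y| < d1 by apply: le_lt_trans (inside y yx) xd1.
    by case/gdg.
  move=> ->; rewrite normrM -sq mulrA ler_wpM2r//.
  by apply/dgub/inside; exact: subset_itvW cmx.
Qed.

Lemma away_from_max f a b u v m : a <= u -> v <= b ->
  {within `[a, b], continuous f} ->
  (forall x, x \in `[u, v] -> f x < f m) ->
  exists2 c, 0 < c & forall x, x \in `[u, v] -> f x - f m <= - c.
Proof.
move=> au vb cf fm.
have [uv|vu] := leP u v; last first.
  exists 1 => // x; rewrite in_itv/= => /andP[ux xv].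
  by have := le_lt_trans (le_trans ux xv) vu; rewrite ltxx.
have cf' : {within `[u, v], continuous f}.
  apply: continuous_subspaceW cf.
  by apply: subset_itv; rewrite bnd_simp.
have [x0 x0uv hx0] := EVT_max uv cf'.
exists (f m - f x0); first by rewrite subr_gt0 fm.
by move=> x xuv; rewrite opprB lerD2r hx0.
Qed.

(** Near [m] the second-order expansion decides; at distance at least [d], compactness gives a fixed
    gap below [f m]. *)
Lemma strict_max_quadratic f df a b m l : a < m < b ->
  {within `[a, b], continuous f} ->
  (forall x, a <= x <= b -> x != m -> f x < f m) ->
  (\forall x \near m, is_derive (x : R) (1 : R) f (df x)) -> df m = 0 ->
  is_derive m 1 df l -> l < 0 ->
  exists2 c, 0 < c & forall x, a <= x <= b -> f x - f m <= - c * (x - m) ^+ 2.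
Proof.
move=> /andP[am mb] cf fmax fdf df0 dfl l0.
(* An error of [- l / 4] against the main coefficient [l / 2] leaves [l / 4 < 0]. *)
have e0 : 0 < - l / 4 by lra.
have /nbhs_ballP[d /= d0 hd] := second_order fdf df0 dfl e0.
have [c1 c10 h1] : exists2 c, 0 < c & forall x, x \in `[a, m - d] -> f x - f m <= - c.
  apply: (@away_from_max f a b) => //; first lra.
  by move=> x; rewrite in_itv/= => /andP[ax xm]; apply: fmax; [|rewrite lt_eqF]; lra.
have [c2 c20 h2] : exists2 c, 0 < c & forall x, x \in `[m + d, b] -> f x - f m <= - c.
  apply: (@away_from_max f a b) => //; first lra.
  by move=> x; rewrite in_itv/= => /andP[ax xm]; apply: fmax; [|rewrite gt_eqF]; lra.
have ba2 : 0 < (b - a) ^+ 2 by rewrite exprn_gt0// subr_gt0; lra.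
(* The gaps [c1] and [c2] become quadratic bounds because [(x - m)^2 <= (b - a)^2]. *)
pose c := Num.min (- l / 4) (Num.min c1 c2 / (b - a) ^+ 2).
have c0 : 0 < c by rewrite !lt_min e0 divr_gt0// lt_min c10.
have far x : a <= x <= b -> c * (x - m) ^+ 2 <= Num.min c1 c2.
  move=> axb; apply: (@le_trans _ _ (c * (b - a) ^+ 2)); last first.
    by rewrite -ler_pdivlMr// ge_min lexx orbT.
  rewrite ler_pM2l// -[leLHS]real_normK ?num_real// lerXn2r ?nnegrE//; first lra.
  by rewrite ler_norml; lra.
exists c => // x axb.
have := far _ axb; rewrite le_min => /andP[f1 f2].
have [xd|xd] := leP x (m - d).
  apply: le_trans (h1 x _) _; first by rewrite in_itv/=; lra.
  by rewrite mulNr lerN2.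
have [xd'|xd'] := leP (m + d) x.
  apply: le_trans (h2 x _) _; first by rewrite in_itv/=; lra.
  by rewrite mulNr lerN2.
have : `|m - x| < d by rewrite ltr_norml; lra.
move=> /hd; rewrite ler_norml => /andP[_].
have cl : c <= - l / 4 by rewrite ge_min lexx.
have := ler_wpM2r (sqr_ge0 (x - m)) cl.
lra.
Qed.

(** With [x = v^2], [x ln x] is [2 v (v ln v)], and [ln (1/v) < 1/v]. This serves the continuity of
    [x ln x] at 0, hence of [H] at -1 and 1. *)
Lemma xlnx_norm_le (x : R) : x <= 1 -> `|x * ln x| <= 2 * Num.sqrt `|x|.
Proof.
move=> x1; have [x0|x0] := leP x 0.
  by rewrite ln0// mulr0 normr0 mulr_ge0// sqrtr_ge0.
rewrite (gtr0_norm x0); set v := Num.sqrt x.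
have v0 : 0 < v by rewrite sqrtr_gt0.
have -> : x = v ^+ 2 by rewrite sqr_sqrtr// ltW.
rewrite lnXn// ler0_norm; last first.
  rewrite mulr_ge0_le0 ?sqr_ge0// mulrn_wle0// ln_le0//.
  by rewrite /v -sqrtr1 ler_wsqrtr.
have : ln v^-1 < v^-1 by rewrite ln_sublinear// invr_gt0.
rewrite lnV ?posrE// => /ltW h.
have -> : - (v ^+ 2 * (ln v *+ 2)) = 2 * (v * (v * - ln v)) by rewrite expr2; ring.
rewrite ler_pM2l// -[leRHS]mulr1 ler_pM2l//.
by rewrite -[leRHS](divff (lt0r_neq0 v0)) ler_pM2l.
Qed.

(** Holds on the whole line because [ln] takes the value 0 at nonpositive arguments. *)
Lemma continuous_xlnx : continuous (fun x : R => x * ln x).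
Proof.
move=> x; have [x0|x0|->] := ltgtP x 0.
- rewrite /continuous_at (ln0 (ltW x0)) mulr0; apply: cvg_near_cst.
  apply: filterS (lt_nbhsl x0) => y y0.
  by rewrite ln0 ?mulr0// ltW.
- by apply: cvgM; [exact: cvg_id|exact: continuous_ln].
- apply/cvgrPdist_le => e e0.
  rewrite mul0r; near=> y; rewrite sub0r normrN.
  apply: le_trans (xlnx_norm_le _) _.
    by apply: ltW; near: y; exact: lt_nbhsl.
  rewrite -ler_pdivlMl// -(@ler_pXn2r _ 2) ?nnegrE ?sqrtr_ge0//; last first.
    by rewrite mulr_ge0// ltW.
  rewrite sqr_sqrtr//.
  near: y; apply/nbhs_ballP; exists ((2^-1 * e) ^+ 2) => /=.
    by rewrite exprn_gt0// mulr_gt0.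
  by move=> y; rewrite /ball/= sub0r normrN => /ltW.
Unshelve. all: by end_near. Qed.

End SecondOrder.

(** * Derivatives of [H] and its shape at the maximizer *)

Section Hfun.
Variable R : realType.
Variables (beta h : R) (p : nat).
Local Notation H := (Hfun beta h p).

Definition Hfun_deriv (x : R) : R :=
  beta * (p%:R * x ^+ p.-1) + h - (ln (1 + x) - ln (1 - x)) / 2.

Lemma continuous_Hfun : continuous H.
Proof.
move=> x; rewrite /continuous_at /Hfun /Ient.
apply: cvgB.
  apply: cvgD; first by apply: cvgM; [exact: cvg_cst|exact: exprn_continuous].
  by apply: cvgM; [exact: cvg_cst|exact: cvg_id].
apply: cvgM; first exact: cvg_cst.
apply: cvgD.
  apply: (@continuous_comp _ _ _ (fun x : R => 1 + x) (fun u => u * ln u)).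
    by apply: cvgD; [exact: cvg_cst|exact: cvg_id].
  exact: continuous_xlnx.
apply: (@continuous_comp _ _ _ (fun x : R => 1 - x) (fun u => u * ln u)).
  by apply: cvgB; [exact: cvg_cst|exact: cvg_id].
exact: continuous_xlnx.
Qed.

Lemma is_derive_ln1D (x : R) : -1 < x ->
  is_derive x 1 (fun y => ln (1 + y)) (1 + x)^-1.
Proof.
move=> x1; have x0 : 0 < 1 + x by lra.
have := is_derive1_ln x0 => dln.
have dx : is_derive x 1 (fun y : R => 1 + y) 1.
  by apply: is_derive_eq; rewrite add0r mulr1.
have := is_derive1_comp (f := @ln R) (g := fun y => 1 + y) dln dx.
by rewrite mulr1.
Qed.

Lemma is_derive_ln1B (x : R) : x < 1 ->
  is_derive x 1 (fun y => ln (1 - y)) (- (1 - x)^-1).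
Proof.
move=> x1; have x0 : 0 < 1 - x by lra.
have := is_derive1_ln x0 => dln.
have dx : is_derive x 1 (fun y : R => 1 - y) (-1).
  by apply: is_derive_eq; rewrite add0r mul1r.
have := is_derive1_comp (f := @ln R) (g := fun y => 1 - y) dln dx.
by rewrite mulrN1.
Qed.

Lemma is_derive_exprn (n : nat) (x : R) :
  is_derive x 1 (fun y => y ^+ n) (n%:R * x ^+ n.-1).
Proof.
apply: DeriveDef; first exact: exprn_derivable.
by rewrite exp_derive /GRing.scale/= mulr1.
Qed.

Lemma is_derive_Hfun (x : R) : -1 < x < 1 -> is_derive x 1 H (Hfun_deriv x).
Proof.
move=> /andP[x1 x2].
have d1 := is_derive_ln1D x1; have d2 := is_derive_ln1B x2.
have u1 : 1 + x != 0 by lra.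
have u2 : 1 - x != 0 by lra.
have e1 : is_derive x 1 (fun y => (1 + y) * ln (1 + y)) (1 + ln (1 + x)).
  have dx : is_derive x 1 (fun y : R => 1 + y) 1.
    by apply: is_derive_eq; rewrite add0r mulr1.
  apply: is_derive_eq (is_deriveM dx d1) _.
  by rewrite /GRing.scale/= divff// mulr1.
have e2 : is_derive x 1 (fun y => (1 - y) * ln (1 - y)) (-1 - ln (1 - x)).
  have dx : is_derive x 1 (fun y : R => 1 - y) (-1).
    by apply: is_derive_eq; rewrite add0r mul1r.
  apply: is_derive_eq (is_deriveM dx d2) _.
  by rewrite /GRing.scale/= mulrN divff// mulrN1.
have e3 : is_derive x 1 (fun y => beta * y ^+ p + h * y)
    (beta * (p%:R * x ^+ p.-1) + h).
  apply: is_derive_eq (is_deriveD (is_deriveZ beta (is_derive_exprn p x))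
    (is_deriveZ h (is_derive_id x 1))) _.
  by rewrite /GRing.scale/= mulr1.
apply: is_derive_eq (is_deriveB e3 (is_deriveZ 2^-1 (is_deriveD e1 e2))) _.
by rewrite /Hfun_deriv /GRing.scale/=; field.
Qed.

Lemma is_derive_Hfun_deriv (x : R) : -1 < x < 1 ->
  exists l, is_derive x 1 Hfun_deriv l.
Proof.
move=> /andP[x1 x2].
have d1 := is_derive_ln1D x1; have d2 := is_derive_ln1B x2.
have e3 : is_derive x 1 (fun y => beta * (p%:R * y ^+ p.-1) + h)
    (beta * (p%:R * (p.-1%:R * x ^+ p.-2)) + 0).
  exact: is_deriveD (is_deriveZ beta (is_deriveZ p%:R (is_derive_exprn p.-1 x)))
    (is_derive_cst h x 1).
have := is_deriveB e3 (is_deriveZ 2^-1 (is_deriveB d1 d2)).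
rewrite (_ : (fun y => _) - _ = Hfun_deriv); first by eexists; eassumption.
apply/funext => y; rewrite /Hfun_deriv !fctE; congr (_ - _).
by rewrite [RHS]mulrC.
Qed.

Lemma near_open_unit (m : R) : -1 < m < 1 -> \forall x \near m, -1 < x < 1.
Proof.
move=> /andP[m1 m2]; near=> x; apply/andP; split; near: x.
  exact: lt_nbhsr.
exact: lt_nbhsl.
Unshelve. all: by end_near. Qed.

Lemma near_is_derive_Hfun (m : R) : -1 < m < 1 ->
  \forall x \near m, is_derive (x : R) (1 : R) H (Hfun_deriv x).
Proof.
move=> m1; apply: filterS (near_open_unit m1) => x; exact: is_derive_Hfun.
Qed.

(** The formula [Hfun_deriv] is established inside [(-1, 1)]; agreement with [derive1 H] near [m] is
    enough to identify the second derivatives at [m]. *)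
Lemma is_derive_derive1_Hfun (m : R) : -1 < m < 1 ->
  is_derive m 1 Hfun_deriv (derive1 (derive1 H) m).
Proof.
move=> m1; have [l dl] := is_derive_Hfun_deriv m1.
suff -> : derive1 (derive1 H) m = l by [].
rewrite derive1E.
transitivity ('D_1 Hfun_deriv m); last by case: dl.
apply: near_eq_derive; apply: filterS (near_is_derive_Hfun m1) => x [_ <-].
by rewrite derive1E.
Qed.

Lemma Hfun_deriv_max (m : R) : -1 < m < 1 ->
  (forall x, -1 <= x <= 1 -> H x <= H m) -> Hfun_deriv m = 0.
Proof.
move=> m1 hm; have [_ <-] := is_derive_Hfun m1.
have [||||_ ->//] := @derive1_at_max R H (-1) 1 m.
- lra.
- by move=> t; rewrite in_itv/= => t1; have [] := is_derive_Hfun t1.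
- by rewrite in_itv.
- by move=> t; rewrite in_itv/= => /andP[t1 t2]; apply: hm; lra.
Qed.

Lemma Hfun_quadratic_ub (m : R) : p_regular beta h p -> -1 < m < 1 ->
  (forall x, -1 <= x <= 1 -> H x <= H m) ->
  derive1 (derive1 H) m < 0 /\
  exists2 c, 0 < c & forall x, -1 <= x <= 1 -> H x - H m <= - c * (x - m) ^+ 2.
Proof.
case=> m' [m'1 hm' d2] m1 hm.
(* The maximizer provided by regularity must be the given [m]; otherwise [H m < H m' <= H m]. *)
have mm' : m' = m.
  apply/eqP; apply: contraT => mm'.
  have hlt : H m < H m' by apply: hm'; [lra|rewrite eq_sym].
  have hle : H m' <= H m by apply: hm; lra.
  by have := lt_le_trans hlt hle; rewrite ltxx.
subst m'; split => //.
apply: (@strict_max_quadratic R H Hfun_deriv (-1) 1 m _ m1 _ hm' _ _ _ d2).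
- exact/continuous_subspaceT/continuous_Hfun.
- exact: near_is_derive_Hfun.
- exact: Hfun_deriv_max.
- exact: is_derive_derive1_Hfun.
Qed.

Lemma Hfun_second_order (m e : R) : -1 < m < 1 ->
  (forall x, -1 <= x <= 1 -> H x <= H m) -> 0 < e ->
  \forall x \near m,
    `|H x - H m - derive1 (derive1 H) m / 2 * (x - m) ^+ 2| <= e * (x - m) ^+ 2.
Proof.
move=> m1 hm; apply: second_order.
- exact: near_is_derive_Hfun.
- exact: Hfun_deriv_max.
- exact: is_derive_derive1_Hfun.
Qed.

End Hfun.

(** * Stirling quotients and a Gaussian bound for the weights *)

Section LaplaceWeights.
Variable R : realType.
Local Notation c := (@stirling_ratio R).

Lemma stirling_ratio_cvg1 (j k : nat -> nat) (b : R) : 0 < b ->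
  (j n)%:R / n.+1%:R @[n --> \oo] --> b -> (k n)%:R / n.+1%:R @[n --> \oo] --> b ->
  c (j n) / c (k n) @[n --> \oo] --> (1 : R).
Proof.
move=> b0 jb kb.
have kj : (k n)%:R / (j n)%:R @[n --> \oo] --> (1 : R).
  have : ((k n)%:R / n.+1%:R) / ((j n)%:R / n.+1%:R) @[n --> \oo] --> b / b.
    by apply: cvgM => //; apply: cvgV => //; exact: lt0r_neq0.
  rewrite divff ?lt0r_neq0//; apply: cvg_trans; apply: near_eq_cvg; apply: nearW => n.
  by rewrite invfM invrK mulrACA mulVf ?mulr1// pnatr_eq0.
have pos (i : nat -> nat) : (i n)%:R / n.+1%:R @[n --> \oo] --> b ->
    \forall n \near \oo, (0 < i n)%N.
  move=> /cvgr_gt/(_ _ b0); apply: filterS => n.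
  by rewrite pmulr_lgt0 ?invr_gt0// ltr0n.
apply/cvgrPdist_le => e e0.
move/cvgrPdist_le : kj => /(_ e e0) kj.
apply: filterS3 kj (pos _ jb) (pos _ kb) => n he j0 k0.
by rewrite distrC (le_trans (stirling_ratio_near1 R j0 k0))// distrC.
Qed.

(** If [v >= - b/2], then [j >= b N / 4] and the first term suffices; otherwise [4 v^2 > b^2] and
    the second term exceeds [N]. *)
Lemma natdiv_le (N j : nat) (b v : R) : 0 < b -> (0 < N)%N ->
  2 * j%:R / N%:R = b + v ->
  N%:R / j.+1%:R <= 4 / b + 4 * (N%:R * v ^+ 2) / b ^+ 2.
Proof.
move=> b0 N0 jE; have N0' : 0 < N%:R :> R by rewrite ltr0n.
have w0 : 0 <= 4 * (N%:R * v ^+ 2) / b ^+ 2.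
  by rewrite divr_ge0 ?sqr_ge0// mulr_ge0// mulr_ge0// sqr_ge0.
have jE' : j%:R = N%:R * (b + v) / 2 :> R by rewrite -jE; field; rewrite lt0r_neq0.
have [vb|vb] := leP (- (b / 2)) v.
  apply: (@le_trans _ _ (4 / b)); last by rewrite lerDl.
  have -> : j.+1%:R = j%:R + 1 :> R by rewrite natr1.
  rewrite ler_pdivrMr ?ltr_wpDl// mulrAC ler_pdivlMr// jE'.
  have : N%:R * (b / 2) <= N%:R * (b + v) by rewrite ler_pM2l//; lra.
  by lra.
apply: (@le_trans _ _ (4 * (N%:R * v ^+ 2) / b ^+ 2)); last first.
  by rewrite lerDr divr_ge0// ltW.
apply: (@le_trans _ _ N%:R).
  by rewrite ler_pdivrMr// ler_peMr ?ler1n.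
rewrite ler_pdivlMr ?exprn_gt0// [leRHS](_ : _ = N%:R * (2 * - v) ^+ 2); last by ring.
by rewrite ler_pM2l// ler_pXn2r ?nnegrE//; lra.
Qed.

(** The mean spin when [k] of the [N] spins point up. *)
Definition gridpt (N k : nat) : R := 2 * k%:R / N%:R - 1.

Lemma gridpt_bound N k : (0 < N)%N -> (k <= N)%N -> -1 <= gridpt N k <= 1.
Proof.
move=> N0 kN; have N0' : 0 < N%:R :> R by rewrite ltr0n.
rewrite /gridpt lerDr lerBlDr divr_ge0 ?mulr_ge0//= ler_pdivrMr//.
have : k%:R <= N%:R :> R by rewrite ler_nat.
lra.
Qed.

Variables (H : R -> R) (m : R).
Hypothesis m1 : -1 < m < 1.

(** The number of up spins that gives mean spin [m], rounded down; it is the reference index for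
    normalizing the weights. *)
Definition midpt (N : nat) : nat := Num.trunc ((1 + m) / 2 * N%:R).

Lemma midpt_le N : (midpt N <= N)%N.
Proof.
have /andP[ml mr] := m1; rewrite /midpt -(@ler_nat R).
have b0 : 0 <= (1 + m) / 2 * N%:R by rewrite mulr_ge0//; lra.
have /andP[h _] := truncn_itv b0; apply: le_trans h _.
by rewrite ler_piMl//; lra.
Qed.

(** By [bin_stirling], proportional in [k] to the binomial coefficient times [exp (N I(x_k))]. *)
Definition binom_ratio (N k : nat) : R :=
  c k / c (midpt N) * (c (N - k) / c (N - midpt N)).

Definition laplace_weight (N k : nat) : R :=
  binom_ratio N k * expR (N%:R * (H (gridpt N k) - H m)).

Lemma binom_ratio_gt0 N k : 0 < binom_ratio N k.
Proof. by rewrite mulr_gt0// divr_gt0// stirling_ratio_gt0. Qed.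

Lemma laplace_weight_gt0 N k : 0 < laplace_weight N k.
Proof. by rewrite mulr_gt0 ?binom_ratio_gt0// expR_gt0. Qed.

(** Put [u = x_k - m]. Up spins are treated with [b = 1 + m], [v = u], down spins with [b = 1 - m],
    [v = - u]. Each quotient is bounded by a multiple of [1 + N u^2], whence the square. *)
Lemma binom_ratio_ub : exists2 K, 0 < K & forall N k, (0 < N)%N -> (k <= N)%N ->
  binom_ratio N k <= K * (1 + N%:R * (gridpt N k - m) ^+ 2) ^+ 2.
Proof.
have /andP[ml mr] := m1.
have b1 : 0 < 1 + m by lra.
have b2 : 0 < 1 - m by lra.
pose C b : R := 1 + 4 / b + 4 / b ^+ 2.
have C0 b : 0 < b -> 0 < C b.
  by move=> b0; rewrite /C !addr_gt0// divr_gt0// exprn_gt0.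
have CP N (i j : nat) b v : 0 < b -> (0 < N)%N -> (i <= N)%N ->
    2 * j%:R / N%:R = b + v ->
    c j / c i <= expR 1 * (C b * (1 + N%:R * v ^+ 2)).
  move=> b0 N0 iN jE; apply: le_trans (stirling_ratio_ub R j i) _.
  rewrite ler_pM2l ?expR_gt0//.
  have w0 : 0 <= N%:R * v ^+ 2 by rewrite mulr_ge0// sqr_ge0.
  apply: (@le_trans _ _ (1 + (4 / b + 4 * (N%:R * v ^+ 2) / b ^+ 2))).
    rewrite lerD2l; apply: le_trans (natdiv_le b0 N0 jE).
    by rewrite ler_pM2r ?invr_gt0// ler_nat.
  have t1 : 0 <= 4 / b by rewrite divr_ge0// ltW.
  have t2 : 0 <= 4 / b ^+ 2 by rewrite divr_ge0// sqr_ge0.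
  rewrite /C [4 * _ / _]mulrAC.
  set w := N%:R * _ in w0 *; set x := 4 / b in t1 *; set y := 4 / b ^+ 2 in t2 *.
  have : 0 <= x * w by rewrite mulr_ge0.
  lra.
exists (expR 1 ^+ 2 * (C (1 + m) * C (1 - m))).
  by rewrite mulr_gt0 ?exprn_gt0 ?expR_gt0// mulr_gt0 ?C0.
move=> N k N0 kN; have N0' : N%:R != 0 :> R by rewrite pnatr_eq0 -lt0n.
set u := gridpt N k - m.
have k1 : 2 * k%:R / N%:R = 1 + m + u by rewrite /u /gridpt; ring.
have k2 : 2 * (N - k)%:R / N%:R = 1 - m + - u.
  by rewrite natrB// /u /gridpt; field.
have r1 := CP N (midpt N) k _ _ b1 N0 (midpt_le N) k1.
have r2 := CP N (N - midpt N)%N (N - k)%N _ _ b2 N0 (leq_subr _ _) k2.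
rewrite /binom_ratio; apply: le_trans (ler_pM _ _ r1 r2) _.
- by rewrite ltW// divr_gt0// stirling_ratio_gt0.
- by rewrite ltW// divr_gt0// stirling_ratio_gt0.
by rewrite sqrrN le_eqVlt; apply/orP; left; apply/eqP; ring.
Qed.

Lemma laplace_weight_ub (a : R) : 0 < a ->
  (forall x, -1 <= x <= 1 -> H x - H m <= - a * (x - m) ^+ 2) ->
  exists2 K, 0 < K & forall N k, (0 < N)%N -> (k <= N)%N ->
  laplace_weight N k <= K * expR (- (a / 2) * (N%:R * (gridpt N k - m) ^+ 2)).
Proof.
move=> a0 Ha; have [K K0 hK] := binom_ratio_ub.
have q0 : 0 < 1 + 4 / a by rewrite addr_gt0// divr_gt0.
exists (K * (1 + 4 / a) ^+ 2); first by rewrite mulr_gt0// exprn_gt0.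
move=> N k N0 kN.
have HN : N%:R * (H (gridpt N k) - H m) <= - a * (N%:R * (gridpt N k - m) ^+ 2).
  by rewrite mulrCA ler_wpM2l// Ha// gridpt_bound.
have := hK N k N0 kN; rewrite /laplace_weight.
set w := N%:R * (gridpt N k - m) ^+ 2 in HN *.
have w0 : 0 <= w by rewrite mulr_ge0// sqr_ge0.
(* Half of the Gaussian exponent absorbs the polynomial: [1 + w <= (1 + 4/a) (1 + a w/4) <= (1 +
   4/a) exp (a w/4)], then square. *)
have w1 : (1 + w) ^+ 2 <= (1 + 4 / a) ^+ 2 * expR (a / 2 * w).
  have -> : expR (a / 2 * w) = expR (a / 4 * w) ^+ 2.
    by rewrite -expRM_natl; congr expR; field.
  rewrite -exprMn ler_pXn2r ?nnegrE ?mulr_ge0 ?expR_ge0//; last 2 first.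
    exact: addr_ge0.
    exact: ltW.
  apply: (@le_trans _ _ ((1 + 4 / a) * (1 + a / 4 * w))).
    rewrite [leRHS](_ : _ = 1 + w + (4 / a + a / 4 * w)); last by field; rewrite lt0r_neq0.
    have h1 : 0 <= 4 / a by rewrite divr_ge0// ltW.
    have h2 : 0 <= a / 4 * w by rewrite mulr_ge0// divr_ge0// ltW.
    by rewrite lerDl addr_ge0.
  by rewrite ler_pM2l// expR_ge1Dx.
move=> hr; apply: (@le_trans _ _ (K * (1 + w) ^+ 2 * expR (- a * w))).
  by apply: ler_pM => //; rewrite ?expR_ge0 ?ler_expR// ltW// binom_ratio_gt0.
apply: (@le_trans _ _ (K * ((1 + 4 / a) ^+ 2 * expR (a / 2 * w)) * expR (- a * w))).
  by rewrite ler_wpM2r ?expR_ge0// ler_pM2l.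
rewrite -!mulrA !ler_pM2l ?exprn_gt0// -expRD ler_expR le_eqVlt; apply/orP; left.
by apply/eqP; field.
Qed.

End LaplaceWeights.

(** * Pointwise limit of the weights in the rescaled coordinate *)

Section LaplaceSums.
Variable R : realType.
Local Notation mu := (@lebesgue_measure R).

Lemma eq1_cvgn (f g : R^nat) (l : R) :
  f =1 g -> f n @[n --> \oo] --> l -> g n @[n --> \oo] --> l.
Proof. by move=> /funext ->. Qed.

Lemma near_sqrt_ge (M : R) : \forall n \near \oo, M <= Num.sqrt n.+1%:R.
Proof.
have := @nbhs_infty_ger R (M ^+ 2); apply: filterS => n hn.
apply: le_trans (ler_norm M) _; rewrite -sqrtr_sqr ler_wsqrtr//.
by rewrite (le_trans hn)// ler_nat.
Qed.

Lemma inv_sqrt_cvg0 : (Num.sqrt n.+1%:R)^-1 @[n --> \oo] --> (0 : R).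
Proof.
apply/cvgrPdist_le => e e0; apply: filterS (near_sqrt_ge e^-1) => n hn.
rewrite sub0r normrN ger0_norm ?invr_ge0 ?sqrtr_ge0//.
by rewrite -[leRHS]invrK lef_pV2// posrE ?invr_gt0// sqrtr_gt0.
Qed.

Variables (H : R -> R) (m kap : R).
Hypotheses (m1 : -1 < m < 1) (kap0 : 0 < kap).
Hypothesis Hloc : forall e, 0 < e ->
  \forall x \near m, `|H x - H m - - kap / 2 * (x - m) ^+ 2| <= e * (x - m) ^+ 2.

Definition scaledpt (N k : nat) : R :=
  kap * Num.sqrt N%:R * (gridpt R N k - m).

Definition spacing (N : nat) : R := 2 * kap / Num.sqrt N%:R.

Lemma spacing_gt0 n : 0 < spacing n.+1.
Proof. by rewrite divr_gt0 ?mulr_gt0 ?sqrtr_gt0. Qed.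

Lemma scaledptE n k :
  scaledpt n.+1 k = scaledpt n.+1 0 + k%:R * spacing n.+1.
Proof.
rewrite /scaledpt /spacing /gridpt mulr0 mul0r.
set s := Num.sqrt _; have s0 : 0 < s by rewrite sqrtr_gt0.
have -> : n.+1%:R = s ^+ 2 by rewrite sqr_sqrtr.
by field; rewrite lt0r_neq0.
Qed.

Definition cellidx (y : R) (n : nat) : nat :=
  Num.trunc ((y - scaledpt n.+1 0) / spacing n.+1).

(** With [N = n + 1], the [N + 1] grid points run from [- kap sqrt N (1 + m)] to
    [kap sqrt N (1 - m)]; as [-1 < m < 1], they eventually surround every [y]. *)
Lemma near_cell (y : R) : \forall n \near \oo, (cellidx y n < n.+2)%N /\
  cell (scaledpt n.+1 0) (spacing n.+1) (cellidx y n) y.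
Proof.
have /andP[ml mr] := m1.
have bl : 0 < kap * (1 + m) by rewrite mulr_gt0//; lra.
have br : 0 < kap * (1 - m) by rewrite mulr_gt0//; lra.
apply: filterS2 (near_sqrt_ge (- y / (kap * (1 + m))))
  (near_sqrt_ge (y / (kap * (1 - m)))) => n.
rewrite !ler_pdivrMr// => h1 h2.
have d0 := spacing_gt0 n.
have y0 : 0 <= y - scaledpt n.+1 0.
  by rewrite /scaledpt /gridpt mulr0 mul0r; lra.
have /andP[t1 t2] := truncn_itv (divr_ge0 y0 (ltW d0)).
rewrite ler_pdivlMr// in t1; rewrite ltr_pdivrMr// in t2.
split; last by rewrite /cell/= in_itv/=; apply/andP; split; lra.
rewrite -(@ltr_nat R) -(ltr_pM2r d0); apply: le_lt_trans t1 _.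
have yN : y <= scaledpt n.+1 n.+1.
  rewrite /scaledpt /gridpt mulfK ?pnatr_eq0//; lra.
rewrite (scaledptE n n.+1) in yN.
have -> : n.+2%:R = n.+1%:R + 1 :> R by rewrite natr1.
lra.
Qed.

Lemma scaledpt_cell_dist n k y :
  cell (scaledpt n.+1 0) (spacing n.+1) k y ->
  `|y - scaledpt n.+1 k| <= spacing n.+1.
Proof.
have kS : k.+1%:R = k%:R + 1 :> R by rewrite natr1.
rewrite /cell/= in_itv/= (scaledptE n k) kS => /andP[h1 h2].
by rewrite ler_norml; apply/andP; split; have := spacing_gt0 n; lra.
Qed.

Lemma scaledpt_cvg y : scaledpt n.+1 (cellidx y n) @[n --> \oo] --> y.
Proof.
apply/cvgrPdist_le => e e0.
apply: filterS2 (near_cell y) (near_sqrt_ge (2 * kap / e)) => n [_ yn] hn.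
apply: le_trans (scaledpt_cell_dist yn) _.
by rewrite ler_pdivrMr ?sqrtr_gt0// (mulrC e) -ler_pdivrMr.
Qed.

Lemma gridpt_scaledpt n k :
  gridpt R n.+1 k = m + scaledpt n.+1 k * (Num.sqrt n.+1%:R)^-1 / kap.
Proof.
rewrite /scaledpt; set s := Num.sqrt _; have s0 : 0 < s by rewrite sqrtr_gt0.
by field; rewrite !lt0r_neq0.
Qed.

Lemma gridpt_cvg y : gridpt R n.+1 (cellidx y n) @[n --> \oo] --> m.
Proof.
suff : m + scaledpt n.+1 (cellidx y n) * (Num.sqrt n.+1%:R)^-1 / kap
    @[n --> \oo] --> m + y * 0 / kap.
  rewrite mulr0 mul0r addr0; apply: eq1_cvgn => n.
  by rewrite gridpt_scaledpt.
apply: cvgD; first exact: cvg_cst.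
apply: cvgM; last exact: cvg_cst.
by apply: cvgM; [exact: scaledpt_cvg|exact: inv_sqrt_cvg0].
Qed.

(** Since [N (x - m)^2 = (z / kap)^2] converges, it stays bounded, and [N] times the second-order
    error of [H] vanishes. What remains is [- kap / 2] times [(y / kap)^2]. *)
Lemma exponent_cvg y : n.+1%:R * (H (gridpt R n.+1 (cellidx y n)) - H m)
  @[n --> \oo] --> - (y ^+ 2 / (2 * kap)).
Proof.
pose u n := gridpt R n.+1 (cellidx y n).
have wE n : n.+1%:R * (u n - m) ^+ 2 = (scaledpt n.+1 (cellidx y n) / kap) ^+ 2.
  rewrite /u gridpt_scaledpt addrAC subrr add0r !exprMn exprVn sqr_sqrtr//.
  by field; rewrite lt0r_neq0//= pnatr_eq0.
have w_cvg : n.+1%:R * (u n - m) ^+ 2 @[n --> \oo] --> (y / kap) ^+ 2.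
  under eq_cvg do rewrite wE.
  apply: (@cvg_comp _ _ _ _ (fun x : R => x ^+ 2)); last exact: exprn_continuous.
  by apply: cvgM; [exact: scaledpt_cvg|exact: cvg_cst].
have small : n.+1%:R * (H (u n) - H m) - - kap / 2 * (n.+1%:R * (u n - m) ^+ 2)
    @[n --> \oo] --> (0 : R).
  apply/cvgrPdist_le => e e0; pose W := (y / kap) ^+ 2 + 1.
  have W0 : 0 < W by rewrite ltr_wpDl// sqr_ge0.
  have near1 : \forall n \near \oo,
      `|H (u n) - H m - - kap / 2 * (u n - m) ^+ 2| <= e / W * (u n - m) ^+ 2.
    exact: (@gridpt_cvg y _ (Hloc (divr_gt0 e0 W0))).
  have near2 : \forall n \near \oo, n.+1%:R * (u n - m) ^+ 2 < W.
    by apply: (cvgr_lt _ w_cvg); rewrite /W ltrDl.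
  apply: filterS2 near1 near2 => n h1 h2.
  rewrite sub0r normrN mulrCA -mulrBr normrM ger0_norm//.
  apply: le_trans (ler_wpM2l _ h1) _ => //.
  by rewrite mulrCA mulrAC ler_pdivrMr// ler_pM2l// ltW.
have -> : - (y ^+ 2 / (2 * kap)) = 0 + - kap / 2 * (y / kap) ^+ 2.
  by field; rewrite lt0r_neq0.
apply: eq1_cvgn (cvgD small (cvgM (cvg_cst (- kap / 2)) w_cvg)) => n.
by rewrite /= subrK.
Qed.

(** Both [cellidx] and [midpt] are asymptotic to [b N] with [b = (1 + m) / 2], so the Stirling
    quotients tend to 1, one at density [b], the other at [1 - b]. *)
Lemma laplace_weight_cvg y : laplace_weight H m n.+1 (cellidx y n)
  @[n --> \oo] --> expR (- (y ^+ 2 / (2 * kap))).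
Proof.
have /andP[ml mr] := m1.
suff : laplace_weight H m n.+1 (cellidx y n) @[n --> \oo] -->
    1 * 1 * expR (- (y ^+ 2 / (2 * kap))) by rewrite !mul1r.
pose b := (1 + m) / 2.
have b0 : 0 < b by rewrite /b; lra.
have b1 : 0 < 1 - b by rewrite /b; lra.
have kb : (cellidx y n)%:R / n.+1%:R @[n --> \oo] --> b.
  rewrite /b [1 + m]addrC.
  suff : (gridpt R n.+1 (cellidx y n) + 1) / 2 @[n --> \oo] --> (m + 1) / 2.
    by apply: eq1_cvgn => n; rewrite /gridpt; field; rewrite addrC natr1 pnatr_eq0.
  apply: cvgM; last exact: cvg_cst.
  by apply: cvgD; [exact: gridpt_cvg|exact: cvg_cst].
(* Rounding down costs at most 1, so the ratio is within [1 / (n + 1)] of [b]. *)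
have jb : (midpt m n.+1)%:R / n.+1%:R @[n --> \oo] --> b.
  apply/cvgrPdist_le => e e0.
  have := @nbhs_infty_ger R e^-1; apply: filterS => n hn.
  have n0 : 0 < n.+1%:R :> R by [].
  have /andP[t1 t2] := truncn_itv (mulr_ge0 (ltW b0) (ltW n0)).
  rewrite -/(midpt m n.+1) in t1 t2.
  have -> : b - (midpt m n.+1)%:R / n.+1%:R = (b * n.+1%:R - (midpt m n.+1)%:R) / n.+1%:R.
    by rewrite mulrBl mulfK// pnatr_eq0.
  rewrite normrM [X in _ * X]ger0_norm ?invr_ge0// ler_pdivrMr//.
  apply: (@le_trans _ _ 1).
    by rewrite ler_norml; move: t2; rewrite -(natr1 (midpt m n.+1)); lra.
  rewrite -ler_pdivrMl// mulr1 (le_trans hn)// ler_nat//.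
have cvg_sub (i : nat -> nat) : (\forall n \near \oo, (i n <= n.+1)%N) ->
    (i n)%:R / n.+1%:R @[n --> \oo] --> b ->
    (n.+1 - i n)%:R / n.+1%:R @[n --> \oo] --> 1 - b.
  move=> ni ib.
  have h : 1 - (i n)%:R / n.+1%:R @[n --> \oo] --> 1 - b.
    by apply: cvgB => //; exact: cvg_cst.
  apply: cvg_trans h.
  apply: near_eq_cvg; apply: filterS ni => n ni.
  by rewrite /= natrB// mulrBl divff// pnatr_eq0.
apply: cvgM.
  apply: cvgM; first exact: stirling_ratio_cvg1 b0 kb jb.
  apply: stirling_ratio_cvg1 b1 _ _; apply: cvg_sub => //.
    by apply: filterS (near_cell y) => n [].
  by apply: nearW => n; exact: midpt_le.
apply: (@cvg_comp _ _ _ _ (@expR R)); first exact: exponent_cvg.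
exact: continuous_expR.
Qed.

End LaplaceSums.

(** * Gaussian limits of the weighted sums *)

Section GaussianLimit.
Variable R : realType.
Local Notation mu := (@lebesgue_measure R).

Lemma cvg_fine_EFin (f : R^nat) (l : R) :
  (f n)%:E @[n --> \oo] --> l%:E -> f n @[n --> \oo] --> l.
Proof. by move=> /fine_cvg. Qed.

(** Carries a bound at a grid point [z] over to every [y] of its cell. Half of [A z^2] absorbs
    [M |z|] by completing a square; the other half controls [y^2] through
    [y^2 <= 2 z^2 + 2 (y - z)^2]. *)
Lemma gauss_exponent_le (A D M y z : R) : 0 < A -> `|y - z| <= D ->
  - A * z ^+ 2 + M * `|z| <= M ^+ 2 / (2 * A) + A * D ^+ 2 / 2 - A / 4 * y ^+ 2.
Proof.
move=> A0 yzD.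
have h1 : M * `|z| <= A * z ^+ 2 / 2 + M ^+ 2 / (2 * A).
  rewrite -subr_ge0 -[z ^+ 2]real_normK ?num_real//.
  rewrite (_ : _ - _ = (A * `|z| - M) ^+ 2 / (2 * A)); last first.
    by field; rewrite lt0r_neq0.
  by rewrite divr_ge0 ?sqr_ge0// mulr_ge0// ltW.
have h2 : (y - z) ^+ 2 <= D ^+ 2.
  rewrite -[leLHS]real_normK ?num_real// ler_pXn2r ?nnegrE//.
  exact: le_trans yzD.
have h3 : 0 <= A * (D ^+ 2 - (y - z) ^+ 2) by rewrite mulr_ge0 ?subr_ge0// ltW.
have h4 : 0 <= A * (y - 2 * z) ^+ 2 by rewrite mulr_ge0 ?sqr_ge0// ltW.
rewrite -subr_ge0.
rewrite (_ : _ - _ = (A * z ^+ 2 / 2 + M ^+ 2 / (2 * A) - M * `|z|)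
  + A * (D ^+ 2 - (y - z) ^+ 2) / 2 + A * (y - 2 * z) ^+ 2 / 4); last by field; rewrite lt0r_neq0.
by rewrite addr_ge0 ?divr_ge0// addr_ge0 ?divr_ge0// subr_ge0.
Qed.

Lemma normal_fun_integrable_bound (A K : R) : 0 < A -> 0 <= K ->
  exists g : R -> R, [/\ forall y, 0 <= g y, mu.-integrable setT (EFin \o g) &
    forall y, g y = K * expR (- A * y ^+ 2)].
Proof.
move=> A0 K0; pose s := Num.sqrt ((2 * A)^-1).
have s0 : s != 0 by rewrite lt0r_neq0// sqrtr_gt0 invr_gt0 mulr_gt0.
pose C := K / normal_peak s.
have p0 := normal_peak_gt0 s0.
exists (fun y => C * normal_pdf 0 s y); split.
- by move=> y; rewrite mulr_ge0 ?normal_pdf_ge0// divr_ge0// ltW.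
- rewrite (_ : EFin \o _ = (fun y => C%:E * (normal_pdf 0 s y)%:E)%E); last first.
    by apply/funext => y /=; rewrite EFinM.
  by apply: integrableZl => //; exact: integrable_normal_pdf.
- move=> y; rewrite normal_pdfE// mulrA /C divfK ?lt0r_neq0//.
  rewrite /normal_fun subr0 sqr_sqrtr ?invr_ge0 ?mulr_ge0 ?(ltW A0)//.
  congr (_ * expR _); field; by rewrite lt0r_neq0.
Qed.

Variables (H : R -> R) (m kap a : R).
Hypotheses (m1 : -1 < m < 1) (kap0 : 0 < kap) (a0 : 0 < a).
Hypothesis Hub : forall x, -1 <= x <= 1 -> H x - H m <= - a * (x - m) ^+ 2.
Hypothesis Hloc : forall e, 0 < e ->
  \forall x \near m, `|H x - H m - - kap / 2 * (x - m) ^+ 2| <= e * (x - m) ^+ 2.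

Definition laplace_sum (n : nat) (psi : R -> R) : R :=
  spacing kap n.+1 *
  \sum_(k < n.+2) laplace_weight H m n.+1 k * psi (scaledpt m kap n.+1 k).

(** The growth condition admits exponentials and, with [M = 0], indicators. Convergence along moving
    points, for almost every [y], accommodates a limit with a jump and test functions varying with
    [n]. *)
Lemma laplace_sum_cvg (psi : nat -> R -> R) (phi : R -> R) (M : R) :
  (forall n z, `|psi n z| <= expR (M * `|z|)) -> measurable_fun setT phi ->
  {ae mu, forall y, forall z : R^nat, z n @[n --> \oo] --> y ->
    psi n (z n) @[n --> \oo] --> phi y} ->
  (laplace_sum n (psi n))%:E @[n --> \oo] -->
    (\int[mu]_y (phi y * expR (- (y ^+ 2 / (2 * kap))))%:E)%E.
Proof.
move=> psiM mphi psi_phi.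
have [K K0 hK] := laplace_weight_ub m1 a0 Hub.
(* The rate [a / 2] of [laplace_weight_ub] in the coordinate [z], as [N (x - m)^2 = z^2 / kap^2]. In
   [B] below, [2 kap] bounds every spacing. *)
pose A := a / 2 / kap ^+ 2.
have A0 : 0 < A by rewrite !divr_gt0// exprn_gt0.
pose B := M ^+ 2 / (2 * A) + A * (2 * kap) ^+ 2 / 2.
have [g [g0 ig gE]] := @normal_fun_integrable_bound (A / 4) (K * expR B)
  (divr_gt0 A0 (ltr0Sn _ _)) (mulr_ge0 (ltW K0) (expR_ge0 _)).
apply: (@riemann_sum_cvg R (fun n => scaledpt m kap n.+1 0) (fun n => spacing kap n.+1)
  (fun n => n.+2) (fun n k => laplace_weight H m n.+1 k * psi n (scaledpt m kap n.+1 k))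
  _ g) => //.
- by move=> n; exact: spacing_gt0.
- apply: measurable_funM => //; apply: measurableT_comp => //.
  apply: measurableT_comp => //; apply: measurable_funM => //.
- move=> n k y kn yk; rewrite normrM gtr0_norm ?laplace_weight_gt0//.
  have := scaledpt_cell_dist kap0 yk; set z := scaledpt _ _ _ _ => yz.
  have D : `|y - z| <= 2 * kap.
    apply: le_trans yz _; rewrite /spacing ler_pdivrMr ?sqrtr_gt0//.
    have s1 : 1 <= Num.sqrt n.+1%:R :> R
      by rewrite -[leLHS]sqrtr1; apply: ler_wsqrtr; rewrite ler1n.
    by apply: ler_peMr => //; rewrite mulr_ge0// ltW.
  have wz : n.+1%:R * (gridpt R n.+1 k - m) ^+ 2 = z ^+ 2 / kap ^+ 2.
    rewrite /z /scaledpt !exprMn sqr_sqrtr//; field.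
    by rewrite lt0r_neq0.
  apply: le_trans (ler_pM _ _ (hK n.+1 k (ltn0Sn _) kn) (psiM n z)) _ => //.
    exact/ltW/laplace_weight_gt0.
  rewrite wz.
  have -> : - (a / 2) * (z ^+ 2 / kap ^+ 2) = - A * z ^+ 2.
    by rewrite /A; field; rewrite lt0r_neq0.
  rewrite gE -[leLHS]mulrA -[leRHS]mulrA ler_pM2l// -!expRD ler_expR.
  by apply: le_trans (gauss_exponent_le M A0 D) _; rewrite /B mulNr.
- move: psi_phi; apply: filterS; first exact: (ae_filter_ringOfSetsType mu).
  move=> y hy; exists (cellidx m kap y).
    by apply: filterS (near_cell m1 kap0 y) => n [kn yk].
  rewrite [phi y * _]mulrC; apply: cvgM.
    exact: (laplace_weight_cvg m1 kap0 Hloc).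
  exact: (hy _ (@scaledpt_cvg _ _ _ m1 kap0 y)).
Qed.

(** Completing the square: [s y - y^2 / (2 kap)] is [kap s^2 / 2] plus the exponent of the normal
    density with mean [kap s] and variance [kap]. *)
Lemma laplace_sum_expR_cvg (s : R) :
  laplace_sum n (fun z => expR (s * z)) @[n --> \oo] -->
  expR (kap * s ^+ 2 / 2) / normal_peak (Num.sqrt kap).
Proof.
have k0 : Num.sqrt kap != 0 by rewrite lt0r_neq0// sqrtr_gt0.
have p0 := normal_peak_gt0 k0.
have := @laplace_sum_cvg (fun _ z => expR (s * z)) (fun z => expR (s * z)) `|s|.
rewrite [X in _ -> _ -> _ -> _ --> X](_ : _ =
  (expR (kap * s ^+ 2 / 2) / normal_peak (Num.sqrt kap))%:E); last first.
  set C := expR _ / _.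
  transitivity (\int[mu]_y (C%:E * (normal_pdf (kap * s) (Num.sqrt kap) y)%:E))%E.
    apply: eq_integral => y _; rewrite -EFinM; congr EFin.
    rewrite normal_pdfE// mulrA /C divfK ?lt0r_neq0// /normal_fun sqr_sqrtr ?ltW//.
    rewrite -!expRD; congr expR; field; by rewrite lt0r_neq0.
  rewrite integralZl//; last exact: integrable_normal_pdf.
  by rewrite integral_normal_pdf mule1.
move=> h; apply: cvg_fine_EFin; apply: h.
- by move=> _ z; rewrite ger0_norm ?expR_ge0// ler_expR -normrM ler_norm.
- by apply: measurableT_comp => //; apply: measurable_funM.
- apply: aeW => y z zy; apply: (@cvg_comp _ _ _ _ (@expR R)).
    by apply: cvgM; [exact: cvg_cst|exact: zy].
  exact: continuous_expR.
Qed.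

Lemma laplace_sum_indicator_cvg (u : R^nat) (t : R) : u n @[n --> \oo] --> t ->
  laplace_sum n (fun z => (z <= u n)%R%:R) @[n --> \oo] -->
  fine (normal_prob 0 (Num.sqrt kap) `]-oo, t]) / normal_peak (Num.sqrt kap).
Proof.
move=> ut.
have k0 : Num.sqrt kap != 0 by rewrite lt0r_neq0// sqrtr_gt0.
have p0 := normal_peak_gt0 k0.
have := @laplace_sum_cvg (fun n z => (z <= u n)%R%:R) (fun z => (z <= t)%R%:R) 0.
rewrite [X in _ -> _ -> _ -> _ --> X](_ : _ =
  (fine (normal_prob 0 (Num.sqrt kap) `]-oo, t]) / normal_peak (Num.sqrt kap))%:E);
    last first.
  rewrite EFinM fineK; last by rewrite fin_num_measure.
  rewrite muleC /normal_prob -integralZl//; last first.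
    by apply: integrableS (integrable_normal_pdf _ _).
  rewrite [RHS]integral_mkcond; apply: eq_integral => y _.
  rewrite /patch/= mem_setE in_itv/=.
  case: ifPn => yt; last by rewrite mul0r.
  rewrite mul1r -EFinM; congr EFin.
  rewrite normal_pdfE// mulrA mulVf ?lt0r_neq0// mul1r /normal_fun subr0 sqr_sqrtr ?ltW//.
  congr expR; field; by rewrite lt0r_neq0.
move=> h; apply: cvg_fine_EFin; apply: h.
- by move=> n z; rewrite mul0r expR0; case: (z <= _); rewrite ?normr1 ?normr0.
- rewrite (_ : (fun z => _) = \1_(`]-oo, t] : set R)); last first.
    by apply/funext => z; rewrite indicE mem_setE in_itv.
  by apply: measurable_indic; exact: measurable_itv.
(* Convergence can fail only at the jump [y = t], a null set. *)
- exists [set t]; split => //; first by rewrite lebesgue_measure_set1.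
  move=> y/=; apply: contra_notP => /eqP yt z zy.
  apply: cvg_near_cst.
  have [ty|ty] := ltP t y.
    (* The midpoint eventually separates [z n] from [u n], so the indicator is eventually
       constant. *)
    pose c := (t + y) / 2.
    have : c < y by rewrite /c; lra.
    move=> /(cvgr_gt _ zy) h1.
    have : t < c by rewrite /c; lra.
    move=> /(cvgr_lt _ ut) h2.
    by apply: filterS2 h1 h2 => n cz uc; rewrite leNgt (lt_trans uc cz).
  have {}ty : y < t by rewrite lt_neqAle yt.
  pose c := (t + y) / 2.
  have : y < c by rewrite /c; lra.
  move=> /(cvgr_lt _ zy) h1.
  have : c < t by rewrite /c; lra.
  move=> /(cvgr_gt _ ut) h2.
  by apply: filterS2 h1 h2 => n zc cu; rewrite (ltW (lt_trans zc cu)).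
Qed.

End GaussianLimit.

(** * From spin configurations to binomial weights *)

Section Configurations.
Variable R : realType.
Local Notation c := (@stirling_ratio R).

Lemma xbar_card (N : nat) (x : config N) : (0 < N)%N ->
  xbar x = gridpt R N #|[set i | x i]%SET|.
Proof.
move=> N0; have N0' : N%:R != 0 :> R by rewrite pnatr_eq0 -lt0n.
rewrite /xbar /gridpt.
have -> : \sum_(i < N) spin R (x i) = 2 * #|[set i | x i]%SET|%:R - N%:R.
  have -> : #|[set i | x i]%SET|%:R = \sum_(i < N) (x i)%:R :> R.
    rewrite -sum1_card natr_sum big_mkcond/=; apply: eq_bigr => i _.
    by rewrite inE; case: (x i).
  have -> : N%:R = \sum_(i < N) 1 :> R by rewrite sumr_const card_ord.
  rewrite mulr_sumr -sumrB; apply: eq_bigr => i _.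
  by rewrite /spin; case: (x i) => /=; ring.
by field.
Qed.

Lemma sum_config (N : nat) (f : R -> R) : (0 < N)%N ->
  \sum_(x : config N) f (xbar x) = \sum_(k < N.+1) 'C(N, k)%:R * f (gridpt R N k).
Proof.
move=> N0.
under eq_bigr do rewrite xbar_card//.
(* Configurations are identified with their sets of up spins, which are then grouped by
   cardinality. *)
rewrite (reindex_onto (fun A : {set 'I_N} => [ffun i => i \in A] : config N)
  (fun x => [set i | x i]%SET)); last first.
  by move=> x _; apply/ffunP => i; rewrite ffunE inE.
under eq_bigl => A.
  rewrite (_ : [set i | _]%SET == A = true); last first.
    by apply/eqP/setP => i; rewrite inE ffunE.
  over.
under eq_bigr => A _.
  rewrite (_ : [set i | _]%SET = A); last by apply/setP => i; rewrite inE ffunE.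
  over.
rewrite (partition_big (fun A : {set 'I_N} => inord #|A| : 'I_N.+1) predT)//=.
apply: eq_bigr => k _.
have cardE (A : {set 'I_N}) : (inord #|A| == k) = (#|A| == k).
  have AN : (#|A| < N.+1)%N by rewrite ltnS -[leqRHS]card_ord max_card.
  by rewrite -val_eqE/= inordK.
under eq_bigl do rewrite cardE.
rewrite (eq_bigr (fun=> f (gridpt R N k))); last by move=> A /eqP ->.
by rewrite sumr_const -cardsE card_draws card_ord mulr_natl.
Qed.

Lemma expR_natln (k : nat) (y : R) : 0 < y ->
  expR (k%:R * ln y) = y ^+ k.
Proof. by move=> y0; rewrite expRM_natl lnK. Qed.

(** The identity [exp (N I(x_k)) = (2k/N)^k (2(N-k)/N)^(N-k)] supplies the powers that complete the
    factorials of the binomial coefficient to [c k] and [c (N - k)]. *)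
Lemma bin_stirling (N k : nat) : (0 < N)%N -> (k <= N)%N ->
  'C(N, k)%:R * expR (N%:R * Ient (gridpt R N k)) =
  N`!%:R * expR N%:R * 2 ^+ N / N%:R ^+ N * (c k * c (N - k)).
Proof.
move=> N0 kN; have N0' : 0 < N%:R :> R by rewrite ltr0n.
have NN : N%:R != 0 :> R by rewrite lt0r_neq0.
have xD : 1 + gridpt R N k = 2 * k%:R / N%:R by rewrite /gridpt; ring.
have xB : 1 - gridpt R N k = 2 * (N - k)%:R / N%:R by rewrite /gridpt natrB//; field.
(* At [j = 0] both sides are 1, whatever the value of [ln 0]. *)
have powE (j : nat) : expR (j%:R * ln (2 * j%:R / N%:R)) = (2 * j%:R / N%:R) ^+ j :> R.
  case: j => [|j]; first by rewrite mul0r expR0 expr0.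
  by rewrite expR_natln// divr_gt0// mulr_gt0.
have -> : N%:R * Ient (gridpt R N k) = k%:R * ln (2 * k%:R / N%:R) +
    (N - k)%:R * ln (2 * (N - k)%:R / N%:R).
  by rewrite /Ient xD xB; field.
rewrite expRD !powE !exprMn !exprVn.
have -> : expR N%:R = expR k%:R * expR (N - k)%:R :> R.
  by rewrite -expRD -natrD subnKC.
have e2 : 2 ^+ N = 2 ^+ k * 2 ^+ (N - k) :> R by rewrite -exprD subnKC.
have eN : N%:R ^+ N = N%:R ^+ k * N%:R ^+ (N - k) :> R by rewrite -exprD subnKC.
rewrite e2 eN -(bin_fact kN) !natrM /stirling_ratio !expRN.
have f1 : k`!%:R != 0 :> R by rewrite pnatr_eq0 -lt0n fact_gt0.
have f2 : (N - k)`!%:R != 0 :> R by rewrite pnatr_eq0 -lt0n fact_gt0.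
have g1 : expR k%:R != 0 :> R by rewrite lt0r_neq0// expR_gt0.
have g2 : expR (N - k)%:R != 0 :> R by rewrite lt0r_neq0// expR_gt0.
have p1 : N%:R ^+ k != 0 :> R by rewrite expf_neq0.
have p2 : N%:R ^+ (N - k) != 0 :> R by rewrite expf_neq0.
move: (N%:R ^+ k) (N%:R ^+ (N - k)) p1 p2 (expR k%:R) (expR (N - k)%:R) g1 g2
  (k`!%:R) ((N - k)`!%:R) f1 f2 => *.
by field; repeat (apply/andP; split).
Qed.

(** The extra field contributes [N (t / sqrt N) x_k = t sqrt N m + (t / kap) z], where [z] is the
    scaled point; the part free of [k] goes into [D]. *)
Lemma bin_weight (n : nat) (beta h m kap t : R) (p : nat) : 0 < kap ->
  exists2 D, 0 < D & forall k, (k <= n.+1)%N ->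
  'C(n.+1, k)%:R * expR (n.+1%:R * (beta * gridpt R n.+1 k ^+ p +
    (h + t / Num.sqrt n.+1%:R) * gridpt R n.+1 k)) =
  D * (laplace_weight (Hfun beta h p) m n.+1 k *
    expR (t / kap * scaledpt m kap n.+1 k)).
Proof.
move=> kap0; set N := n.+1; set s := Num.sqrt _.
have s0 : 0 < s by rewrite sqrtr_gt0.
have NE : N%:R = s ^+ 2 by rewrite sqr_sqrtr.
pose A := N`!%:R * expR N%:R * 2 ^+ N / N%:R ^+ N : R.
have A0 : 0 < A.
  by rewrite !(mulr_gt0, invr_gt0) ?exprn_gt0 ?expR_gt0// ltr0n fact_gt0.
have c0 k := @stirling_ratio_gt0 R k.
pose k0 := midpt m N.
exists (A * (c k0 * c (N - k0)) * expR (N%:R * Hfun beta h p m + t * s * m)).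
  by rewrite mulr_gt0 ?expR_gt0// mulr_gt0// mulr_gt0.
move=> k kN.
have -> : N%:R * (beta * gridpt R N k ^+ p + (h + t / s) * gridpt R N k) =
    N%:R * Ient (gridpt R N k) + (N%:R * Hfun beta h p (gridpt R N k) + t * s * gridpt R N k).
  by rewrite /Hfun NE; field; rewrite lt0r_neq0.
rewrite expRD mulrA bin_stirling// -/A /laplace_weight /binom_ratio -/k0.
rewrite [RHS](_ : _ = A * (c k * c (N - k)) *
  (expR (N%:R * Hfun beta h p m + t * s * m) *
   expR (N%:R * (Hfun beta h p (gridpt R N k) - Hfun beta h p m)) *
   expR (t / kap * scaledpt m kap N k))); last first.
  by field; rewrite !lt0r_neq0.
congr (_ * _); rewrite -!expRD; congr expR.
by rewrite /scaledpt -/s; field; rewrite lt0r_neq0.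
Qed.

End Configurations.

(** * The mean spin as a function of the field, and the maximum likelihood estimate *)

Section MaximumLikelihood.
Variable R : realType.

Lemma continuous_sumr (I : Type) (r : seq I) (f : I -> R -> R) :
  (forall i, continuous (f i)) -> continuous (fun h => \sum_(i <- r) f i h).
Proof.
move=> cf; elim: r => [|i r ih] h.
  by rewrite /continuous_at big_nil; under eq_cvg do rewrite big_nil; exact: cvg_cst.
rewrite /continuous_at big_cons; under eq_cvg do rewrite big_cons.
by apply: cvgD; [exact: cf|exact: ih].
Qed.

Lemma cw_probE (N : nat) (beta h : R) (p : nat) (x : config N) :
  cw_prob beta h p x = cw_weight beta h p x / \sum_(y : config N) cw_weight beta h p y.
Proof. by rewrite /cw_prob /cw_Z mulVKf// expf_neq0. Qed.

Lemma cw_weight_sum_gt0 (N : nat) (beta h : R) (p : nat) :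
  0 < \sum_(y : config N) cw_weight beta h p y.
Proof.
rewrite (bigD1 [ffun=> true])//= ltr_pwDl ?expR_gt0// sumr_ge0// => y _.
exact: expR_ge0.
Qed.

Lemma cw_mean_ratio (N : nat) (beta h : R) (p : nat) :
  cw_mean N beta h p = (\sum_(x : config N) cw_weight beta h p x * xbar x) /
    \sum_(y : config N) cw_weight beta h p y.
Proof.
by rewrite /cw_mean mulr_suml; apply: eq_bigr => x _; rewrite cw_probE mulrAC.
Qed.

Lemma xbar_itv (N : nat) (x : config N) : (0 < N)%N -> -1 <= (xbar x : R) <= 1.
Proof.
move=> N0; rewrite xbar_card// gridpt_bound//.
by rewrite -[leqRHS]card_ord max_card.
Qed.

Lemma xbar_const (N : nat) (b : bool) : (0 < N)%N ->
  xbar ([ffun=> b] : config N) = spin R b.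
Proof.
move=> N0; rewrite /xbar (eq_bigr (fun=> spin R b)); last by move=> i _; rewrite ffunE.
rewrite (_ : \sum_(i < N) _ = N%:R * spin R b); first by rewrite mulKf// pnatr_eq0 -lt0n.
by rewrite sumr_const card_ord mulr_natl.
Qed.

Variables (N : nat) (beta : R) (p : nat).
Hypothesis N0 : (0 < N)%N.
Local Notation base x := (expR (N%:R * (beta * xbar x ^+ p))).

(* [cw_mean - c] up to a positive factor, normalized so that every summand is
   nondecreasing in the field [h]. *)
Definition tilt (c h : R) : R := \sum_(x : config N)
  base x * (expR (N%:R * h * (xbar x - c)) * (xbar x - c)).

Lemma tilt_term_lt (a h1 h2 : R) : h1 < h2 -> a != 0 ->
  expR (N%:R * h1 * a) * a < expR (N%:R * h2 * a) * a.
Proof.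
move=> h12; have N1 : 0 < N%:R :> R by rewrite ltr0n.
rewrite neq_lt => /orP[a0|a0].
  by rewrite ltr_nM2r// ltr_expR ltr_nM2r// ltr_pM2l.
by rewrite ltr_pM2r// ltr_expR ltr_pM2r// ltr_pM2l.
Qed.

Lemma tilt_term_le (a h1 h2 : R) : h1 <= h2 ->
  expR (N%:R * h1 * a) * a <= expR (N%:R * h2 * a) * a.
Proof.
rewrite le_eqVlt => /predU1P[->//|h12].
by have [->|a0] := eqVneq a 0; [rewrite !mulr0|exact/ltW/tilt_term_lt].
Qed.

Lemma tilt_lt (c : R) : {homo tilt c : h1 h2 / h1 < h2}.
Proof.
move=> h1 h2 h12.
(* The constant configurations have mean spins 1 and -1, so one of them differs from [c] and makes
   the inequality strict. *)
have [x0 x0c] : exists x : config N, xbar x - c != 0.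
  have [c1|c1] := eqVneq c 1.
    by exists [ffun=> false]; rewrite xbar_const// c1 /spin/=; lra.
  by exists [ffun=> true]; rewrite xbar_const// /spin subr_eq0 eq_sym.
rewrite /tilt (bigD1 x0)//= [ltRHS](bigD1 x0)//=; apply: ltr_leD.
  by rewrite ltr_pM2l ?expR_gt0// tilt_term_lt.
by apply: ler_sum => x _; rewrite ler_pM2l ?expR_gt0// tilt_term_le// ltW.
Qed.

Lemma cw_meanB (c h : R) : cw_mean N beta h p - c =
  tilt c h * (expR (N%:R * h * c) / \sum_(y : config N) cw_weight beta h p y).
Proof.
have S0 := cw_weight_sum_gt0 N beta h p.
rewrite cw_mean_ratio mulrA -[X in _ - X](mulfK (lt0r_neq0 S0)) -mulrBl.
congr (_ / _); rewrite mulr_sumr -sumrB /tilt mulr_suml; apply: eq_bigr => x _.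
rewrite /cw_weight (mulrC c) -mulrBr mulrA mulrAC; congr (_ * _).
by rewrite mulrAC mulrA -!expRD; congr expR; ring.
Qed.

Lemma cw_mean_pos_factor (c h : R) :
  0 < expR (N%:R * h * c) / \sum_(y : config N) cw_weight beta h p y.
Proof. by rewrite divr_gt0 ?expR_gt0// cw_weight_sum_gt0. Qed.

(** With [c] the mean in the field [h1], [tilt c] vanishes at [h1] and is strictly increasing, hence
    positive at [h2]. *)
Lemma cw_mean_lt : {homo (fun h => cw_mean N beta h p) : h1 h2 / h1 < h2}.
Proof.
move=> h1 h2 h12; rewrite -subr_gt0 cw_meanB pmulr_lgt0 ?cw_mean_pos_factor//.
have -> : 0 = tilt (cw_mean N beta h1 p) h1.
  apply/eqP; have := cw_meanB (cw_mean N beta h1 p) h1.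
  by rewrite subrr => /esym/eqP; rewrite mulf_eq0 (gt_eqF (cw_mean_pos_factor _ _)) orbF eq_sym.
exact: tilt_lt.
Qed.

Lemma cw_mean_le : {mono (fun h => cw_mean N beta h p) : h1 h2 / h1 <= h2}.
Proof. exact: le_mono cw_mean_lt. Qed.

Lemma cw_mean_itv (h : R) : -1 < cw_mean N beta h p < 1.
Proof.
have := xbar_itv _ N0 => xb.
apply/andP; split.
  rewrite -subr_gt0 cw_meanB pmulr_lgt0 ?cw_mean_pos_factor// /tilt.
  rewrite (bigD1 [ffun=> true])//= ltr_pwDl//.
    by rewrite !(mulr_gt0, expR_gt0)// xbar_const// /spin; lra.
  apply: sumr_ge0 => x _; rewrite !(mulr_ge0, expR_ge0)//.
  by have := xb x; lra.
rewrite -subr_lt0 cw_meanB pmulr_llt0 ?cw_mean_pos_factor// /tilt.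
rewrite -oppr_gt0 -sumrN (bigD1 [ffun=> false])//= ltr_pwDl//.
  rewrite -!mulrN !(mulr_gt0, expR_gt0)// xbar_const// /spin; lra.
apply: sumr_ge0 => x _; rewrite -!mulrN !(mulr_ge0, expR_ge0)//.
by have := xb x; lra.
Qed.

Lemma continuous_tilt (c : R) : continuous (tilt c).
Proof.
apply: continuous_sumr => x h.
apply: cvgM; first exact: cvg_cst.
apply: cvgM; last exact: cvg_cst.
apply: (@cvg_comp _ _ _ _ (@expR R)); last exact: continuous_expR.
by apply: cvgM; [apply: cvgM; [exact: cvg_cst|exact: cvg_id]|exact: cvg_cst].
Qed.

(** The all-up term grows at least linearly by [exp x >= 1 + x], and the other terms are
    nondecreasing in [h]. [tilt_le] is the mirror image with the all-down configuration; together
    they supply the sign change for the intermediate value theorem. *)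
Lemma tilt_ge (c h : R) : c < 1 -> 0 <= h ->
  tilt c 0 + h * (expR (N%:R * beta) * (N%:R * (1 - c) ^+ 2)) <= tilt c h.
Proof.
move=> c1 h0; rewrite /tilt (bigD1 [ffun=> true])//= [leRHS](bigD1 [ffun=> true])//=.
rewrite addrAC; apply: lerD; last first.
  by apply: ler_sum => x _; rewrite ler_pM2l ?expR_gt0// tilt_term_le.
rewrite xbar_const// /spin expr1n mulr1 mulr0 mul0r expR0 mul1r.
set a := 1 - c; have a0 : 0 < a by rewrite subr_gt0.
rewrite [leLHS](_ : _ = expR (N%:R * beta) * ((1 + N%:R * h * a) * a)); last by ring.
by rewrite ler_pM2l ?expR_gt0// ler_pM2r// expR_ge1Dx.
Qed.

Lemma tilt_le (c h : R) : -1 < c -> h <= 0 ->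
  tilt c h <= tilt c 0 + h * (expR (N%:R * (beta * (-1) ^+ p)) * (N%:R * (1 + c) ^+ 2)).
Proof.
move=> c1 h0; rewrite /tilt (bigD1 [ffun=> false])//= [leRHS]addrC.
rewrite [X in _ <= _ + X](bigD1 [ffun=> false])//= addrA; apply: lerD; last first.
  by apply: ler_sum => x _; rewrite ler_pM2l ?expR_gt0// tilt_term_le.
rewrite xbar_const// /spin mulr0 mul0r expR0 mul1r.
set a := -1 - c; have a0 : a < 0 by rewrite /a; lra.
set E := expR (_ * (beta * _)).
rewrite [leRHS](_ : _ = E * ((1 + N%:R * h * a) * a)); last by rewrite /a; ring.
by rewrite ler_pM2l ?expR_gt0// ler_nM2r// expR_ge1Dx.
Qed.

Lemma cw_mean_surj (c : R) : -1 < c < 1 -> exists h, cw_mean N beta h p = c.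
Proof.
move=> /andP[c1 c2]; have N1 : 0 < N%:R :> R by rewrite ltr0n.
pose T := `|tilt c 0|.
pose B1 := expR (N%:R * beta) * (N%:R * (1 - c) ^+ 2).
pose B2 := expR (N%:R * (beta * (-1) ^+ p)) * (N%:R * (1 + c) ^+ 2).
have B10 : 0 < B1 by rewrite mulr_gt0 ?expR_gt0// mulr_gt0// exprn_gt0//; lra.
have B20 : 0 < B2 by rewrite mulr_gt0 ?expR_gt0// mulr_gt0// exprn_gt0//; lra.
have T0 : 0 <= T by exact: normr_ge0.
(* In the fields [T / B1] and [- (T / B2)] the linear terms compensate [tilt c 0]. *)
have h10 : 0 <= T / B1 by rewrite divr_ge0// ltW.
have h20 : - (T / B2) <= 0 by rewrite oppr_le0 divr_ge0// ltW.
have p1 : 0 <= tilt c (T / B1).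
  apply: le_trans (tilt_ge c2 h10); rewrite -/B1 divfK ?lt0r_neq0//.
  by have := ler_norm (- tilt c 0); rewrite normrN -/T; lra.
have p2 : tilt c (- (T / B2)) <= 0.
  apply: le_trans (tilt_le c1 h20) _; rewrite -/B2 mulNr divfK ?lt0r_neq0//.
  by have := ler_norm (tilt c 0); rewrite -/T; lra.
have [|||h _ hE] := @IVT R (tilt c) (- (T / B2)) (T / B1) 0.
- exact: le_trans h20 h10.
- exact/continuous_subspaceT/continuous_tilt.
- by rewrite ge_min le_max p2 p1 orbT.
by exists h; apply/eqP; rewrite -subr_eq0 cw_meanB hE mul0r.
Qed.

(** As the mean increases strictly with the field, comparing fields is comparing means. Infinite
    estimates go with mean spin 1 or -1, and means in finite fields lie strictly between, so the
    equivalence persists there. *)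
Lemma mle_h_le (x : config N) (h t : R) :
  ((Num.sqrt (N%:R : R))%:E * (mle_h N beta p x - h%:E) <= t%:E)%E =
  (xbar x <= cw_mean N beta (h + t / Num.sqrt N%:R) p).
Proof.
set s := Num.sqrt _; have s0 : 0 < s by rewrite sqrtr_gt0 ltr0n.
(* The likelihood equation always has a solution in the extended reals, so the default value of
   [xget] never occurs. *)
have ex : exists e : \bar R, cw_meanE N beta p e = xbar x.
  have := @xbar_itv N x N0.
  have [->|x1] := eqVneq (xbar x) (1 : R); first by exists +oo%E.
  have [->|xm1] := eqVneq (xbar x) (-1 : R); first by exists -oo%E.
  move=> /andP[h1 h2]; have [|h' hE] := @cw_mean_surj (xbar x).
    by rewrite !lt_neqAle h1 h2 x1 eq_sym xm1.
  by exists h'%:E.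
have /= := xgetPex 0%E ex; rewrite -/(mle_h N beta p x).
case: (mle_h N beta p x) => [r| |] /=.
- by move=> <-; rewrite -EFinB -EFinM lee_fin cw_mean_le -lerBlDl ler_pdivlMr// mulrC.
- move=> <-; rewrite addye// gt0_muley ?lte_fin// leye_eq/=.
  by apply/esym/negbTE; rewrite -ltNge; have /andP[] := cw_mean_itv (h + t / s).
- move=> <-; rewrite addNye gt0_muleNy ?lte_fin// leNye.
  by apply/esym/ltW; have /andP[] := cw_mean_itv (h + t / s).
Qed.

End MaximumLikelihood.

(** * Convergence of a mean from bounds by exponential moments *)

Section TiltedMean.
Variable R : realType.

Lemma expR_le1D2x (v : R) : 0 <= v -> v <= 2^-1 -> expR v <= 1 + 2 * v.
Proof.
move=> v0 v2; have e0 := expR_ge0 v.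
have h1 := expR_ge1Dx (- v); have h2 := expRxMexpNx_1 v.
have h3 : expR v * (1 - v) <= 1 by rewrite -[leRHS]h2 ler_wpM2l.
have v1 : 0 < 1 - v by lra.
rewrite -(ler_pM2r v1); apply: le_trans h3 _.
rewrite [leRHS](_ : _ = 1 + v * (1 - 2 * v)); last by ring.
by rewrite lerDl mulr_ge0//; lra.
Qed.

(** Using [eps] and [- eps] bounds [|u n - t|] asymptotically by
    [(exp (kap eps^2 / 2) - 1) / |eps|], which is of order [kap |eps| / 2]. *)
Lemma cvg_from_exp_moments (kap t : R) (u : R^nat) : 0 < kap ->
  (forall eps, exists2 v : R^nat, v n @[n --> \oo] --> expR (kap * eps ^+ 2 / 2) - 1 &
    forall n, eps * (u n - t) <= v n) ->
  u n @[n --> \oo] --> t.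
Proof.
move=> k0 huv; apply/cvgrPdist_le => e e0.
(* Small enough that [kap eps^2 <= 1] and [kap eps <= e / 2]; then [exp (kap eps^2 / 2) - 1 <= kap
   eps^2 < eps e]. *)
pose eps := Num.min 1 (e / 2) / (1 + kap).
have k1 : 0 < 1 + kap by lra.
have eps0 : 0 < eps by rewrite divr_gt0// lt_min ltr01 divr_gt0.
have epsE : eps * (1 + kap) = Num.min 1 (e / 2) by rewrite divfK// lt0r_neq0.
have eps1 : eps * (1 + kap) <= 1 by rewrite epsE ge_min lexx.
have eps2 : eps * (1 + kap) <= e / 2 by rewrite epsE ge_min lexx orbT.
have ke : 0 < eps * kap by rewrite mulr_gt0.
have small : expR (kap * eps ^+ 2 / 2) - 1 < eps * e.
  have w0 : 0 <= kap * eps ^+ 2 / 2 by rewrite divr_ge0// mulr_ge0 ?sqr_ge0// ltW.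
  have w1 : kap * eps ^+ 2 <= 1 * 1.
    rewrite expr2 mulrA (mulrC kap); apply: ler_pM; lra.
  have := expR_le1D2x w0; rewrite mulr1 in w1.
  have : eps * (eps * kap) < eps * e by rewrite ltr_pM2l//; lra.
  rewrite expr2; lra.
have [v1 cv1 hv1] := huv eps.
have [v2 cv2 hv2] := huv (- eps).
rewrite sqrrN in cv2.
apply: filterS2 (cvgr_lt _ cv1 _ small) (cvgr_lt _ cv2 _ small) => n h1 h2.
have /ltW := le_lt_trans (hv1 n) h1; rewrite ler_pM2l// => g1.
have /ltW := le_lt_trans (hv2 n) h2; rewrite mulNr -mulrN ler_pM2l// => g2.
by rewrite ler_norml; lra.
Qed.

End TiltedMean.

(** * Limits under the Curie-Weiss measure *)

Section CurieWeiss.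
Variable R : realType.
Variables (p : nat) (beta h m kap a : R).
Local Notation H := (Hfun beta h p).
Hypotheses (m1 : -1 < m < 1) (kap0 : 0 < kap) (a0 : 0 < a).
Hypothesis Hub : forall x, -1 <= x <= 1 -> H x - H m <= - a * (x - m) ^+ 2.
Hypothesis Hloc : forall e, 0 < e ->
  \forall x \near m, `|H x - H m - - kap / 2 * (x - m) ^+ 2| <= e * (x - m) ^+ 2.
Local Notation L n psi := (laplace_sum H m kap n psi).

Definition fluct (n : nat) (x : R) : R := kap * Num.sqrt n.+1%:R * (x - m).

Definition local_field (t : R) (n : nat) : R := h + t / Num.sqrt n.+1%:R.

Lemma laplace_sum_gt0 n (f : R -> R) : (forall z, 0 < f z) -> 0 < L n f.
Proof.
move=> f0; rewrite /laplace_sum mulr_gt0//; first exact: spacing_gt0.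
rewrite big_ord_recl ltr_pwDl//; first by rewrite mulr_gt0// laplace_weight_gt0.
by apply: sumr_ge0 => k _; rewrite mulr_ge0// ltW// laplace_weight_gt0.
Qed.

Lemma laplace_sum_homo n (f g : R -> R) : (forall z, f z <= g z) -> L n f <= L n g.
Proof.
move=> fg; rewrite /laplace_sum ler_pM2l ?spacing_gt0//.
by apply: ler_sum => k _; rewrite ler_pM2l ?laplace_weight_gt0.
Qed.

Lemma laplace_sumZ n (f : R -> R) (b : R) : L n (fun z => b * f z) = b * L n f.
Proof.
rewrite /laplace_sum [RHS]mulrCA; congr (_ * _); rewrite mulr_sumr.
by apply: eq_bigr => k _; ring.
Qed.

Lemma laplace_sumD n (f g : R -> R) (b : R) :
  L n (fun z => f z + b * g z) = L n f + b * L n g.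
Proof.
rewrite /laplace_sum [b * _]mulrCA -mulrDr; congr (_ * _).
rewrite mulr_sumr -big_split/=.
by apply: eq_bigr => k _; ring.
Qed.

(** One constant [D] serves all [f], so it cancels from every expectation. *)
Lemma sum_cw_weight n t : exists2 D, 0 < D & forall f : R -> R,
  \sum_(x : config n.+1) cw_weight beta (local_field t n) p x * f (fluct n (xbar x)) =
  D * L n (fun z => expR (t / kap * z) * f z).
Proof.
have [D D0 hD] := @bin_weight R n beta h m kap t p kap0.
have s0 := spacing_gt0 kap0 n.
exists (D / spacing kap n.+1); first by rewrite divr_gt0.
move=> f; rewrite /cw_weight.
rewrite (@sum_config R n.+1 (fun y => expR (n.+1%:R * (beta * y ^+ p +
  local_field t n * y)) * f (fluct n y)))//.
rewrite /laplace_sum mulrA divfK ?lt0r_neq0// mulr_sumr; apply: eq_bigr => k _.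
rewrite mulrA hD//; last by rewrite -ltnS ltn_ord.
by rewrite !mulrA.
Qed.

(** [fluct n] is affine and therefore passes through the expectation. *)
Lemma fluct_mean n t :
  fluct n (cw_mean n.+1 beta (local_field t n) p) =
  L n (fun z => expR (t / kap * z) * z) / L n (fun z => expR (t / kap * z)).
Proof.
have [D D0 hD] := sum_cw_weight n t.
have S0 := cw_weight_sum_gt0 n.+1 beta (local_field t n) p.
have S1 : \sum_(x : config n.+1) cw_weight beta (local_field t n) p x =
    D * L n (fun z => expR (t / kap * z)).
  have := hD (fun=> 1); under eq_bigr do rewrite mulr1.
  by under [X in laplace_sum _ _ _ _ X]funext do rewrite mulr1.
have S2 := hD id.
rewrite -(mulfK (lt0r_neq0 S0) (fluct n _)) {1}/fluct cw_mean_ratio.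
set S := \sum_(x : config n.+1) cw_weight _ _ _ _ in S0 S1 *.
rewrite [X in X / _](_ : _ = D * L n (fun z => expR (t / kap * z) * z)).
  by rewrite S1 invfM mulrACA divff ?lt0r_neq0// mul1r.
rewrite -S2 [LHS](_ : _ = kap * Num.sqrt n.+1%:R *
    (\sum_(x : config n.+1) cw_weight beta (local_field t n) p x * xbar x - m * S)).
  rewrite /S mulr_sumr -sumrB mulr_sumr; apply: eq_bigr => x _; rewrite /fluct /=; ring.
by field; rewrite lt0r_neq0.
Qed.

(** Averaging [eps (z - t) <= exp (eps (z - t)) - 1] over the tilted weights bounds the mean by a
    quotient of exponential sums. That quotient tends to [exp (kap eps^2 / 2)], as [kap s = t]
    cancels the terms linear in [eps]. *)
Lemma fluct_mean_cvg t :
  fluct n (cw_mean n.+1 beta (local_field t n) p) @[n --> \oo] --> t.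
Proof.
pose s := t / kap.
have sE : kap * s = t by rewrite /s mulrC divfK// lt0r_neq0.
have L0 n : 0 < L n (fun z => expR (s * z)) by apply: laplace_sum_gt0 => z; exact: expR_gt0.
have pk : normal_peak (Num.sqrt kap) != 0.
  by rewrite lt0r_neq0// normal_peak_gt0// lt0r_neq0// sqrtr_gt0.
apply: (cvg_from_exp_moments kap0) => eps.
exists (fun n => expR (- eps * t) * L n (fun z => expR ((s + eps) * z)) /
  L n (fun z => expR (s * z)) - 1).
  have c1 := @laplace_sum_expR_cvg R H m kap a m1 kap0 a0 Hub Hloc (s + eps).
  have c2 := @laplace_sum_expR_cvg R H m kap a m1 kap0 a0 Hub Hloc s.
  apply: cvgB; last exact: cvg_cst.
  rewrite [X in _ --> X](_ : _ = expR (- eps * t) *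
    (expR (kap * (s + eps) ^+ 2 / 2) / normal_peak (Num.sqrt kap)) /
    (expR (kap * s ^+ 2 / 2) / normal_peak (Num.sqrt kap))); last first.
    set E1 := expR (kap * (s + eps) ^+ 2 / 2).
    set E2 := expR (kap * s ^+ 2 / 2); have E20 : E2 != 0 by rewrite lt0r_neq0// expR_gt0.
    rewrite [RHS](_ : _ = expR (- eps * t) * (E1 / E2)).
      by rewrite /E1 /E2 -expRN -!expRD; congr expR; rewrite -sE; field.
    by field; rewrite E20 pk.
  apply: cvgM; first by apply: cvgM => //; exact: cvg_cst.
  apply: cvgV => //.
  by apply: mulf_neq0; [exact/lt0r_neq0/expR_gt0|rewrite invr_neq0].
move=> n; rewrite fluct_mean -/s.
rewrite lerBrDr ler_pdivlMr//.
rewrite [leLHS](_ : _ = L n (fun z => expR (s * z) +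
  eps * (expR (s * z) * z + (- t) * expR (s * z)))).
  rewrite -laplace_sumZ; apply: laplace_sum_homo => z.
  have -> : expR (- eps * t) * expR ((s + eps) * z) = expR (s * z) * expR (eps * (z - t)).
    by rewrite -!expRD; congr expR; ring.
  rewrite [leLHS](_ : _ = expR (s * z) * (1 + eps * (z - t))); last by ring.
  by rewrite ler_pM2l ?expR_gt0// expR_ge1Dx.
rewrite (laplace_sumD n _ (fun z => expR (s * z) * z + (- t) * expR (s * z))) laplace_sumD.
by field; rewrite lt0r_neq0.
Qed.

(** [fluct n] is increasing, so the event reads [z <= u n], where the rescaled mean [u n] tends to
    [t]. The probability is a quotient of two sums without tilt, in whose limit the factors
    [normal_peak] cancel. *)
Lemma laplace_prob_cvg t :
  cw_Prob n.+1 beta h p (fun x => xbar x <= cw_mean n.+1 beta (local_field t n) p)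
    @[n --> \oo] --> fine (normal_prob 0 (Num.sqrt kap) `]-oo, t]).
Proof.
have pk : normal_peak (Num.sqrt kap) != 0.
  by rewrite lt0r_neq0// normal_peak_gt0// lt0r_neq0// sqrtr_gt0.
pose u n := fluct n (cw_mean n.+1 beta (local_field t n) p).
have c1 := laplace_sum_indicator_cvg m1 kap0 a0 Hub Hloc (@fluct_mean_cvg t).
(* The total mass is the exponential sum at [s = 0]. *)
have c2 := @laplace_sum_expR_cvg R H m kap a m1 kap0 a0 Hub Hloc 0.
suff : L n (fun z => (z <= u n)%R%:R) / L n (fun z => expR (0 * z)) @[n --> \oo] -->
    fine (normal_prob 0 (Num.sqrt kap) `]-oo, t]) / normal_peak (Num.sqrt kap) /
    (expR (kap * 0 ^+ 2 / 2) / normal_peak (Num.sqrt kap)).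
  have -> : kap * 0 ^+ 2 / 2 = 0 by ring.
  rewrite expR0 div1r invrK divfK//.
  apply: eq1_cvgn => n.
  have [D D0 hD] := sum_cw_weight n 0.
  have loc0 : local_field 0 n = h by rewrite /local_field mul0r addr0.
  rewrite loc0 in hD.
  have e0 (f : R -> R) : (fun z => expR (0 / kap * z) * f z) = f.
    by apply/funext => z; rewrite mul0r mul0r expR0 mul1r.
  have S1 := hD (fun=> 1); have S2 := hD (fun z => (z <= u n)%R%:R).
  rewrite e0 in S1; rewrite e0 in S2.
  rewrite (_ : (fun z => expR (0 * z)) = fun=> 1); last first.
    by apply/funext => z; rewrite mul0r expR0.
  rewrite /cw_Prob; under [RHS]eq_bigr do rewrite cw_probE.
  rewrite -mulr_suml.
  have S1' : \sum_(x : config n.+1) cw_weight beta h p x = D * L n (fun=> 1).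
    by rewrite -S1; apply: eq_bigr => x _; rewrite mulr1.
  rewrite S1' [RHS](_ : _ = D * L n (fun z => (z <= u n)%R%:R) / (D * L n (fun=> 1))).
    by rewrite -[RHS]mulf_div divff ?lt0r_neq0// mul1r.
  congr (_ / _); rewrite -S2 big_mkcond/=; apply: eq_bigr => x _.
  rewrite /u /fluct ler_pM2l ?mulr_gt0 ?sqrtr_gt0// lerD2r.
  by case: ifP; rewrite ?mulr1 ?mulr0.
apply: cvgM => //; apply: cvgV => //.
by apply: mulf_neq0; [exact/lt0r_neq0/expR_gt0|rewrite invr_neq0].
Qed.

End CurieWeiss.

Theorem mainTheorem3 (R : realType) (p : nat) (beta h m : R) :
  (3 <= p)%N -> 0 <= beta ->
  p_regular beta h p ->
  -1 < m < 1 ->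
  (forall x, -1 <= x <= 1 -> Hfun beta h p x <= Hfun beta h p m) ->
  forall t : R,
    (fun N : nat =>
       (cw_Prob N beta h p
          (fun x => ((Num.sqrt (N%:R : R))%:E * (mle_h N beta p x - h%:E) <= t%:E)%E))%:E)
      @ \oo -->
    normal_prob 0 (Num.sqrt (- derive1 (derive1 (Hfun beta h p)) m)) `]-oo, t].
Proof.
move=> _ _ reg m1 hm t.
have [d2 [a a0 Hub]] := Hfun_quadratic_ub reg m1 hm.
set kap := - derive1 _ m.
have kap0 : 0 < kap by rewrite oppr_gt0.
have Hloc e : 0 < e -> \forall x \near m,
    `|Hfun beta h p x - Hfun beta h p m - - kap / 2 * (x - m) ^+ 2| <= e * (x - m) ^+ 2.
  by rewrite opprK; exact: Hfun_second_order.
rewrite -[normal_prob _ _ _]fineK; last by rewrite fin_num_measure.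
(* Passing to [N = n + 1] guarantees at least one spin. *)
rewrite -cvg_shiftS.
apply: cvg_EFin; first exact: nearW.
apply: eq1_cvgn (laplace_prob_cvg m1 kap0 a0 Hub Hloc (t := t)) => n.
by rewrite /= /cw_Prob; apply: eq_bigl => x; rewrite mle_h_le.
Qed.
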